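(* For every $(x_0,v_0)\in\mathbb T^2\times S^1$ and every target $(x',v')\in\mathbb T^2\times S^1$, there exists a smooth control $\sigma_\theta h\in C^\infty([0,1];L^2)$ such that the solution of the controlled system (see context) with initial data $(\mathbf u^h_0,\theta^h_0,x^h_0,v^h_0,A^h_0)=(\mathbf 0,0,x_0,v_0,\mathrm{Id}_{\mathbb R^2})$ satisfies $$(\mathbf u^h_1,\theta^h_1,x^h_1,v^h_1)=(\mathbf 0,0,x',v').$$ Furthermore, the control $\sigma_\theta h$ can be chosen to depend smoothly on $x_0,x',v_0,v'$ and to be supported only in frequencies $|k|_\infty\le2$.
   Context: $\mathbb T^2=[0,2\pi]^2$ with periodic boundary conditions; $\nu_1,\nu_2>0$ with $\min\{\nu_1,\nu_2\}<2$, $g\neq0$, $\mathbf g=(0,g)^T$ fixed. Given a control $\sigma_\theta h=\sigma_\theta h(x,t)$, the controlled system for $(\mathbf u^h,\theta^h,x^h,v^h,A^h)\in H^5(\mathbb T^2)\times H^5(\mathbb T^2)\times\mathbb T^2\times S^1\times\mathrm{SL}_2(\mathbb R)$ is the Boussinesq system with the control as temperature forcing, $$\partial_t\mathbf u^h+\mathbf u^h\cdot\nabla\mathbf u^h=-\nabla p+\nu_1\Delta\mathbf u^h+\mathbf g\theta^h,\quad \partial_t\theta^h+\mathbf u^h\cdot\nabla\theta^h=\nu_2\Delta\theta^h+\sigma_\theta h,\quad\nabla\cdot\mathbf u^h=0,$$ coupled with $\dot x^h=\mathbf u^h(x^h)$, $\dot v^h=\big(v^h\cdot\nabla\mathbf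 u^h(x^h)\cdot(v^h)^\perp\big)(v^h)^\perp$, $\dot A^h=A^h\nabla\mathbf u^h(x^h)$ (with $(\nabla\mathbf u)_{ij}=\partial_iu_j$). Controls may depend on space through their coefficients: they have the form $\sigma_\theta h(x,t)=\sum_{k\in\hat{\mathcal Z},\,l\in\{0,1\}}\sigma_k^l(x)h_k^l(x,t)$, where $\hat{\mathcal Z}\subset\mathbb Z^2$ is a finite symmetric index set containing $(1,0),(0,1),(0,2),(1,1),(-1,1)$, and $\sigma_k^0(x)=\cos(k\cdot x)$, $\sigma_k^1(x)=\sin(k\cdot x)$. ''Supported only in frequencies $|k|_\infty\le2$'' means that only indices $k$ with $|k|_\infty=\max(|k_1|,|k_2|)\le2$ occur in this sum.
   Formalization: Smooth dependence on x_0, x', v_0, v' is proved in lifted coordinates (points of R^2 and angles in R), hence locally on the torus and circle; a globally continuous choice on (T^2 x S^1)^2 is impossible, since it would make T^2 x S^1 contractible. *)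

(* Defs.v *)
From HB Require Import structures.
From mathcomp Require Import all_boot all_order all_algebra finmap.
From mathcomp Require Import all_classical all_reals all_analysis.
Set Implicit Arguments.
Unset Strict Implicit.
Unset Printing Implicit Defensive.
Import Order.TTheory GRing.Theory Num.Theory.
Import numFieldNormedType.Exports.
Local Open Scope classical_set_scope.
Local Open Scope ring_scope.

(* Points of the torus R^2 / (2 pi Z)^2 are represented by their lifts in
   R * R; functions on the torus are the periodic functions on R * R, and
   integrals run over the fundamental domain [0, 2 pi]^2. *)

Section Torus.
Context {R : realType}.
Implicit Types (x y : R * R) (f : R * R -> R) (k : int * int).

Definition torus_eq x y :=
  exists m n : int,
    x.1 = y.1 + 2 * pi * m%:~R /\ x.2 = y.2 + 2 * pi * n%:~R.

Definition torus_periodic f := forall x y, torus_eq x y -> f x = f y.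

Definition torus_cell : set (measurableTypeR R * measurableTypeR R) :=
  `[0, 2 * pi] `*` `[0, 2 * pi].

Lemma measurable_torus_cell : measurable torus_cell.
Proof. by apply: measurableX; exact: measurable_itv. Qed.

Definition torus_measure
    : {measure set (measurableTypeR R * measurableTypeR R) -> \bar R} :=
  mrestr (lebesgue_measure \x lebesgue_measure)%E measurable_torus_cell.

Definition in_L2 f := torus_periodic f /\ f \in Lfun torus_measure 2%:E.

Definition L2_norm f : \bar R := 'N[torus_measure]_(2%:E)[EFin \o f]%E.

(* [c'] is the derivative at [t], in the norm of L^2, of the curve [c] defined
   on [I]; it is one-sided at the end points of an interval [I]. *)
Definition L2_derivative (I : set R) (c : R -> R * R -> R) (t : R)
    (c' : R * R -> R) :=
  L2_norm (fun y => (s - t)^-1 * (c s y - c t y) - c' y)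
    @[s --> within I t^'] --> 0%E.

(* [F] is C^infinity from [D] into L^2: it has iterated directional derivatives
   [G s] along all finite sequences [s] of directions, all of them continuous
   on [D].  It is meant for convex sets [D] with non-empty interior that
   contain, for every point [q] and direction [w], points [q + e *: w] with
   [e] arbitrarily small (an interval, or the product of one with a space). *)
Definition smooth_L2 (E : normedModType R) (D : set E)
    (F : E -> R * R -> R) :=
  exists G : seq E -> E -> R * R -> R,
    [/\ forall q, D q -> G [::] q = F q,
        forall s q, D q -> in_L2 (G s q),
        forall s q, D q ->
          L2_norm (fun y => G s q' y - G s q y)
            @[q' --> within D (nbhs q)] --> 0%E
      & forall s w q, D q ->
          L2_norm (fun y =>
              e^-1 * (G s (q + e *: w) y - G s q y) - G (w :: s) q y)
            @[e --> within [set e | D (q + e *: w)] 0^'] --> 0%E].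

Definition wave k (l : bool) x : R :=
  let a := k.1%:~R * x.1 + k.2%:~R * x.2 in if l then sin a else cos a.

Definition fourier f k (l : bool) : R :=
  (4 * pi ^+ 2)^-1 * Rintegral torus_measure setT (fun x => f x * wave k l x).

(* The squared norm of H^5, sum_k (1 + |k|^2)^5 |\hat f(k)|^2, where
   \hat f(k) = fourier f k false - i fourier f k true. *)
Definition H5_sqnorm f : \bar R :=
  (\esum_(k in [set: int * int])
    ((1 + k.1%:~R ^+ 2 + k.2%:~R ^+ 2) ^+ 5 *
     (fourier f k false ^+ 2 + fourier f k true ^+ 2))%:E)%E.

(* Elements of H^5 are represented by their continuous versions, which are
   C^3 by Sobolev embedding; the classical derivatives below hence exist. *)
Definition H5 f := [/\ torus_periodic f, continuous f & (H5_sqnorm f < +oo)%E].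

Definition H5_curve (I : set R) (c : R -> R * R -> R) :=
  (forall t, I t -> H5 (c t)) /\
  (forall t, I t ->
    H5_sqnorm (fun y => c s y - c t y) @[s --> within I (nbhs t)] --> 0%E).

Definition pderiv (i : 'I_2) f x : R :=
  'D_(if i == 0 then (1, 0) else (0, 1) : R * R) f x.

Definition laplacian f x : R := \sum_i pderiv i (pderiv i f) x.

Definition divergence (u : 'I_2 -> R * R -> R) x : R := \sum_i pderiv i (u i) x.

Definition advection (u : 'I_2 -> R * R -> R) f x : R :=
  \sum_i u i x * pderiv i f x.

Definition velocity_grad (u : 'I_2 -> R * R -> R) x : 'M[R]_2 :=
  \matrix_(i, j) pderiv i (u j) x.

End Torus.

Section System.
Context {R : realType}.

Definition row2 (a b : R) : 'rV[R]_2 := \row_j (if j == 0 then a else b).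

Definition perp (v : 'rV[R]_2) : 'rV[R]_2 := row2 (- v 0 1) (v 0 0).

Definition on_circle (v : 'rV[R]_2) := \sum_j v 0 j ^+ 2 = 1.

Definition direction (phi : R) : 'rV[R]_2 := row2 (cos phi) (sin phi).

Definition gravity (g : R) (j : 'I_2) : R := if j == 0 then 0 else g.

(* Solutions on [0, 1], [F] being the forcing of the temperature; the pressure
   of a solution with values in H^5 is itself in H^5 by elliptic regularity.
   The time derivatives of u and theta are taken in L^2, where the forcing
   lives; energy estimates show that the initial data determine the solution
   in this class (p up to constants, x up to the choice of a lift). *)
Record controlled_solution (nu1 nu2 g : R) (F : R -> R * R -> R)
    (u : R -> 'I_2 -> R * R -> R) (theta : R -> R * R -> R)
    (x : R -> R * R) (v : R -> 'rV[R]_2) (A : R -> 'M[R]_2) : Prop := {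
  velocity_H5 : forall j, H5_curve `[0, 1] (fun t => u t j) ;
  temperature_H5 : H5_curve `[0, 1] theta ;
  momentum_eq : exists p : R -> R * R -> R,
    (forall t : R, 0 <= t <= 1 -> H5 (p t)) /\
    forall j (t : R), 0 <= t <= 1 ->
      L2_derivative `[0, 1] (fun s => u s j) t
        (fun y => - advection (u t) (u t j) y - pderiv j (p t) y
                  + nu1 * laplacian (u t j) y + gravity g j * theta t y) ;
  temperature_eq : forall t : R, 0 <= t <= 1 ->
    L2_derivative `[0, 1] theta t
      (fun y => - advection (u t) (theta t) y
                + nu2 * laplacian (theta t) y + F t y) ;
  incompressibility : forall (t : R) y, 0 <= t <= 1 -> divergence (u t) y = 0 ;
  position_continuous : {within `[0, 1], continuous x} ;
  position_eq : forall t : R, 0 < t < 1 ->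
    is_derive t 1 (fun s => (x s).1) (u t 0 (x t)) /\
    is_derive t 1 (fun s => (x s).2) (u t 1 (x t)) ;
  direction_circle : forall t : R, 0 <= t <= 1 -> on_circle (v t) ;
  direction_continuous : forall j, {within `[0, 1], continuous (fun s => v s 0 j)} ;
  direction_eq : forall (t : R) j, 0 < t < 1 ->
    is_derive t 1 (fun s => v s 0 j)
      (((v t *m velocity_grad (u t) (x t) *m (perp (v t))^T) 0 0 *: perp (v t)) 0 j) ;
  jacobian_SL2 : forall t : R, 0 <= t <= 1 -> \det (A t) = 1 ;
  jacobian_continuous : forall i j,
    {within `[0, 1], continuous (fun s => A s i j)} ;
  jacobian_eq : forall (t : R) i j, 0 < t < 1 ->
    is_derive t 1 (fun s => A s i j) ((A t *m velocity_grad (u t) (x t)) i j)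
}.

(* Coefficients h_k^l(x, t), with [l = false] for cosines and [l = true] for
   sines. *)
Definition control := int * int -> bool -> R -> R * R -> R.

Definition control_field (Z : {fset int * int}) (h : control)
    (t : R) (y : R * R) : R :=
  \sum_(k <- Z) \sum_(l : bool) wave k l y * h k l t y.

Definition smooth_control (Z : {fset int * int}) (h : control) :=
  (forall k l (t : R), k \in Z -> 0 <= t <= 1 -> in_L2 (h k l t)) /\
  smooth_L2 (`[0, 1] : set R^o) (control_field Z h).

Definition low_frequency (h : control) :=
  forall (k : int * int) l t y,
    2 < Num.max `|k.1| `|k.2| -> h k l t y = 0.

Definition steers (nu1 nu2 g : R) (Z : {fset int * int}) (h : control)
    (x0 : R * R) (v0 : 'rV[R]_2) (x1 : R * R) (v1 : 'rV[R]_2) :=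
  exists u theta x v A,
    [/\ controlled_solution nu1 nu2 g (control_field Z h) u theta x v A,
        (forall j y, u 0 j y = 0) /\ (forall y, theta 0 y = 0),
        [/\ torus_eq (x 0) x0, v 0 = v0 & A 0 = 1%:M],
        (forall j y, u 1 j y = 0) /\ (forall y, theta 1 y = 0)
      & torus_eq (x 1) x1 /\ v 1 = v1].

(* A lifted configuration: coordinates of a point of the torus, and an angle
   for a point of the circle. *)
Definition lifted_config : normedModType R := ((R^o * R^o) * R^o)%type.

(* Smooth dependence is understood in the coordinates (x, phi) of R^2 * R, that
   is on the universal cover of T^2 * S^1 (hence locally on T^2 * S^1).  A
   selection that is continuous on all of (T^2 * S^1)^2 is impossible: the
   trajectories (x, v) would give paths depending continuously on their end
   points, and T^2 * S^1 would be contractible.  Smoothness of a map into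
   C^infinity([0, 1]; L^2) is joint smoothness in the parameters and time. *)
Definition smooth_family (Z : {fset int * int})
    (H : lifted_config -> lifted_config -> control) :=
  smooth_L2
    ([set q | 0 <= (q.2 : R) <= 1] : set (lifted_config * lifted_config * R^o)%type)
    (fun q => control_field Z (H q.1.1 q.1.2) q.2).

End System.

(* Main.v *)
Require Import Defs.
From HB Require Import structures.
From mathcomp Require Import all_boot all_order all_algebra finmap.
From mathcomp Require Import all_classical all_reals all_analysis measurable_realfun.
From mathcomp Require Import ring lra.
(* Two shear flows, with phases y1 + y2 and y1 - y2 centred at a prescribed
   trajectory, form a divergence-free velocity whose value at the trajectory is
   any prescribed velocity and whose gradient there is any prescribed infinitesimal
   rotation.
   The momentum equation is then solved by an explicit pressure and an explicit
   temperature, since the nonlinearity of two crossing shears is, up to a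
   gradient, vertical.  The temperature equation defines the forcing.  All fields are
   trigonometric polynomials in space whose coefficients are elementary
   functions of the end points and the time, which makes the smoothness claims
   and the convergence in L^2 and H^5 statements about finitely many
   coefficients. *)

Set Implicit Arguments.
Unset Strict Implicit.
Unset Printing Implicit Defensive.
Import Order.TTheory GRing.Theory Num.Theory.
Import numFieldNormedType.Exports.
Local Open Scope classical_set_scope.
Local Open Scope ring_scope.

(** Buoyancy acts on the vertical component only, so the pressure alone has to balance the
    horizontal one. This is why the phases are diagonal: both shears vary with y1, and every
    horizontal term is a y1-derivative of a periodic function. A shear depending on y2 alone could
    not be driven like this, since no periodic pressure cancels a horizontal term constant in y1.
    Neither shear advects itself. Write f1, f2 for the shears and primes for phase derivatives. The
    advection is -2 (f1 f2' + f1' f2) horizontally, the y1-derivative of -2 f1 f2, and 2 (f2 f1' -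
    f1 f2') vertically; the temperature takes up what the pressure leaves in the vertical equation.
    The unknowns match the task: two amplitudes for the velocity, one common phase slope for the
    angular velocity. Position and angle follow a straight segment in lifted coordinates with a time
    profile. The velocity contains the first derivative of the profile and the temperature also the
    second, so both must vanish at the ends; the quintic [step] is the polynomial of least degree
    that goes from 0 to 1 in this way. *)

Section Fubini.

(** * Integrals of plane waves over the torus *)

Context {R : realType}.
Implicit Types (k : int * int) (l : bool) (f : R * R -> R).

Lemma periodic_int (f : R -> R) T (n : int) a :
  periodic f T -> f (a + T * n%:~R) = f a.
Proof.
move=> fT; case: n => n; rewrite ?NegzE -?pmulrn.
  by rewrite mulr_natr periodicn.
by rewrite -{2}(subrK (T * n.+1%:R) a) mulr_natr periodicn// mulrNz mulrN
  -pmulrn mulr_natr.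
Qed.

Lemma cosD2pin (a : R) (n : int) : cos (a + 2 * pi * n%:~R) = cos a.
Proof. by rewrite mulr_natl periodic_int//; exact: cosD2pi. Qed.

Lemma integral_cos_affine (n : int) (c : R) : n != 0 ->
  (\int[lebesgue_measure]_(x in `[0%R, (2 * pi)%R]) (cos (n%:~R * x + c))%:E = 0)%E.
Proof.
move=> n0; have n0' : n%:~R != 0 :> R by rewrite intr_eq0.
pose F (x : R) := n%:~R^-1 * sin (n%:~R * x + c).
have dF (x : R) : is_derive x (1 : R) F (cos (n%:~R * x + c)).
  by apply: is_derive_eq; rewrite addr0 /GRing.scale/= mulr1 mulrC mulfK.
have F_continuous (x : R) : {for x, continuous F}.
  by apply: differentiable_continuous; apply/derivable1_diffP; apply: ex_derive.
rewrite (@continuous_FTC2 _ _ F).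
(* Both sines become cosines shifted by [pi / 2], so that [cosD2pin] absorbs the whole number [n] of
   periods between the end points. *)
- rewrite /F mulr0 add0r -EFinB -mulrBr -(cosBpihalf (_ + c)) -(cosBpihalf c).
  rewrite [X in cos X - _](_ : _ = c - pi / 2 + 2 * pi * n%:~R); last by ring.
  by rewrite cosD2pin subrr mulr0.
- by rewrite mulr_gt0// pi_gt0.
- apply: continuous_subspaceT => x.
  apply: continuous_comp; last exact: continuous_cos.
  by apply: cvgD; [apply: cvgM; [exact: cvg_cst|exact: cvg_id]|exact: cvg_cst].
- split=> [x _|//|].
  + exact: ex_derive.
  + exact/cvg_at_right_filter/F_continuous.
  + exact/cvg_at_left_filter/F_continuous.
- by move=> x _; rewrite derive1E; apply: derive_val.
Qed.

Lemma wave_continuous k l : continuous (wave k l : R * R -> R).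
Proof.
move=> x; have kc : {for x, continuous
    (fun x : R * R => k.1%:~R * x.1 + k.2%:~R * x.2)}.
  apply: cvgD; apply: cvgM; try exact: cvg_cst; [exact: cvg_fst|exact: cvg_snd].
rewrite /wave; case: l => /=; apply: (continuous_comp kc).
  exact: continuous_sin.
exact: continuous_cos.
Qed.

(** Treating sine as a shifted cosine, periodicity, bounds, measurability and integrals of both
    kinds of wave are proved once. *)
Lemma waveE k l (x : R * R) :
  wave k l x = cos (k.1%:~R * x.1 + k.2%:~R * x.2 - if l then pi / 2 else 0).
Proof. by rewrite /wave; case: l; rewrite ?cosBpihalf ?subr0. Qed.

Lemma wave_periodic k l : torus_periodic (wave k l : R * R -> R).
Proof.
move=> x y [m [n [x1 x2]]]; rewrite !waveE x1 x2; set s := (X in _ - X).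
rewrite [X in cos X](_ : _ = k.1%:~R * y.1 + k.2%:~R * y.2 - s
   + 2 * pi * (k.1 * m + k.2 * n)%:~R) ?cosD2pin//.
by rewrite rmorphD !rmorphM/=; ring.
Qed.

Lemma wave_le1 k l (x : R * R) : `|wave k l x| <= 1.
Proof. by rewrite waveE ler_norml cos_geN1 cos_le1. Qed.

Lemma wave_measurable k l :
  measurable_fun setT
    (wave k l : measurableTypeR R * measurableTypeR R -> measurableTypeR R).
Proof.
rewrite (_ : wave k l = fun x =>
  cos (k.1%:~R * x.1 + k.2%:~R * x.2 - if l then pi / 2 else 0));
  last by apply/funext => x; exact: waveE.
apply: (measurableT_comp (continuous_measurable_fun (@continuous_cos R))).
apply: measurable_funB => //.
by apply: measurable_funD; apply: measurable_funM.
Qed.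

Lemma torus_cell_measure :
  ((lebesgue_measure \x lebesgue_measure)%E (@torus_cell R)
   = (4 * pi ^+ 2)%:E)%E.
Proof.
have itvE : lebesgue_measure (`[0%R, (2 * pi)%R] : set R) = (2 * pi)%:E.
  by rewrite lebesgue_measure_itv/= lte_fin mulr_gt0 ?pi_gt0// -EFinB subr0.
rewrite product_measure1E; [|exact: measurable_itv..].
transitivity ((2 * pi : R)%:E * (2 * pi)%:E)%E; first by congr (_ * _)%E.
by rewrite -EFinM; congr EFin; ring.
Qed.

Lemma torus_measure_setT : torus_measure setT = (4 * pi ^+ 2 : R)%:E.
Proof. by rewrite /torus_measure/= /mrestr setTI torus_cell_measure. Qed.

Lemma torus_measure_lty : (torus_measure (R := R) setT < +oo)%E.
Proof. by rewrite torus_measure_setT ltry. Qed.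

Lemma bounded_torus_integrable f (B : R) :
  measurable_fun setT (f : measurableTypeR R * measurableTypeR R -> measurableTypeR R) ->
  (forall x, `|f x| <= B) -> torus_measure.-integrable setT (EFin \o f).
Proof.
move=> mf fB; apply: measurable_bounded_integrable => //.
  exact: torus_measure_lty.
exists B; split; first exact: num_real.
by move=> M BM x _; apply: le_trans (fB x) (ltW BM).
Qed.

(** [torus_measure] lives on the whole plane with no mass outside the cell; passing to the product
    measure on the cell makes Fubini applicable. *)
Lemma integral_torus f (B : R) :
  measurable_fun setT (f : measurableTypeR R * measurableTypeR R -> measurableTypeR R) ->
  (forall x, `|f x| <= B) ->
  (\int[torus_measure]_x (f x)%:E =
   \int[lebesgue_measure \x lebesgue_measure]_(x in torus_cell) (f x)%:E)%E.
Proof.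
move=> mf fB.
have mC : measurable (~` @torus_cell R).
  exact: measurableC (measurable_torus_cell (R := R)).
have C0 : torus_measure (~` @torus_cell R) = 0%E.
  by rewrite /torus_measure/= /mrestr setICl measure0.
have E := negligible_integral mC measurableT (bounded_torus_integrable mf fB) C0.
rewrite setTD setCK in E.
apply: etrans E _; apply: eq_measure_integral => A mA AD.
by rewrite /torus_measure/= /mrestr setIidl.
Qed.

(** Integrating first in a variable whose frequency component is nonzero already gives 0; the other
    variable only enters the constant shift of the cosine. *)
Lemma integral_wave k l : k != 0 ->
  (\int[torus_measure]_x (wave k l x : R)%:E = 0)%E.
Proof.
move=> k0; rewrite (@integral_torus _ 1)//; [|exact: wave_measurable|exact: wave_le1].
rewrite integral_mkcond.
set f := (X in (\int[_]_x X x)%E).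
have cell_lty : ((lebesgue_measure \x lebesgue_measure)%E (@torus_cell R) < +oo)%E.
  by rewrite torus_cell_measure ltry.
have fi : (lebesgue_measure \x lebesgue_measure)%E.-integrable setT f.
  apply/(integrable_mkcond _ measurable_torus_cell).
  apply: measurable_bounded_integrable.
  - exact: measurable_torus_cell.
  - exact: cell_lty.
  - exact: (measurable_funS _ (@subsetT _ _) (wave_measurable _ _)).
  - exists 1; split; first exact: num_real.
    by move=> M BM x _; apply: le_trans (wave_le1 _ _ _) (ltW BM).
pose s : R := if l then pi / 2 else 0.
have cellE x y : f (x, y) = if x \in `[0%R, (2 * pi)%R] then
    if y \in `[0%R, (2 * pi)%R] then (wave k l (x, y))%:E else 0%E else 0%E.
  rewrite /f patchE in_setX /= !mem_setE.
  by case: (x \in _); case: (y \in _).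
have [k2|k2] := eqVneq k.2 0; last first.
  rewrite -integral12_prod_meas1//; apply: integral0_eq => x _; rewrite /fubini_F.
  have [xI|xI] := boolP (x \in `[0%R, (2 * pi)%R]); last first.
    by apply: integral0_eq => y _; rewrite [LHS]cellE (negbTE xI).
  rewrite -(integral_cos_affine (k.1%:~R * x - s) k2) [in RHS]integral_mkcond.
  apply: eq_integral => y _; rewrite [LHS]cellE xI patchE mem_setE waveE/=.
  by case: (y \in _); rewrite // addrA (addrC (k.2%:~R * y)).
have k1 : k.1 != 0.
  by apply: contra_neq k0 => k1; rewrite (surjective_pairing k) k1 k2.
rewrite -integral21_prod_meas1//; apply: integral0_eq => y _; rewrite /fubini_G.
have [yI|yI] := boolP (y \in `[0%R, (2 * pi)%R]); last first.
  by apply: integral0_eq => x _; rewrite [LHS]cellE (negbTE yI); case: ifP.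
rewrite -(integral_cos_affine (k.2%:~R * y - s) k1) [in RHS]integral_mkcond.
apply: eq_integral => x _; rewrite [LHS]cellE yI patchE mem_setE waveE/=.
by case: (x \in _); rewrite // addrA.
Qed.

End Fubini.

(** * Products, finite sums and Fourier coefficients of waves *)

Section Waves.
Context {R : realType}.
Implicit Types (k : int * int) (l : bool) (f : R * R -> R).

(** The product-to-sum formulas at once: like waves give cosines, mixed ones sines. The minus signs
    come from cos a sin b on the difference and from sin a sin b on the sum. *)
Lemma wave_mul k l k' l' (x : R * R) :
  wave k l x * wave k' l' x =
  (-1) ^+ (~~ l && l') / 2 * wave (k - k') (l (+) l') x +
  (-1) ^+ (l && l') / 2 * wave (k + k') (l (+) l') x.
Proof.
have Z1 (m n : int) : (m - n)%:~R = m%:~R - n%:~R :> R by rewrite rmorphB.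
have Z2 (m n : int) : (m + n)%:~R = m%:~R + n%:~R :> R by rewrite rmorphD.
have [kB1 kB2] : (k - k').1 = k.1 - k'.1 /\ (k - k').2 = k.2 - k'.2 by [].
have [kD1 kD2] : (k + k').1 = k.1 + k'.1 /\ (k + k').2 = k.2 + k'.2 by [].
rewrite /wave kB1 kB2 kD1 kD2 !Z1 !Z2 {Z1 Z2 kB1 kB2 kD1 kD2}.
set a := k.1%:~R * x.1 + k.2%:~R * x.2; set b := k'.1%:~R * x.1 + k'.2%:~R * x.2.
rewrite !mulrBl !mulrDl.
have -> : k.1%:~R * x.1 - k'.1%:~R * x.1 + (k.2%:~R * x.2 - k'.2%:~R * x.2) = a - b.
  by rewrite /a /b; ring.
have -> : k.1%:~R * x.1 + k'.1%:~R * x.1 + (k.2%:~R * x.2 + k'.2%:~R * x.2) = a + b.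
  by rewrite /a /b; ring.
clearbody a b.
by case: l l' => -[] /=; rewrite ?expr0 ?expr1 ?cosB ?cosD ?sinB ?sinD; field.
Qed.

Definition trig_sum (s : seq (R * ((int * int) * bool))) (x : R * R) : R :=
  \sum_(c <- s) c.1 * wave c.2.1 c.2.2 x.

(** The l^1 norm of the coefficients. It bounds the sup norm and, up to constants depending on the
    frequencies only, the norms of L^2 and H^5; convergence below is reduced to amplitudes tending
    to 0. *)
Definition amplitude (s : seq (R * ((int * int) * bool))) : R :=
  \sum_(c <- s) `|c.1|.

Implicit Type s : seq (R * ((int * int) * bool)).

Lemma amplitude_ge0 s : 0 <= amplitude s.
Proof. by apply: sumr_ge0. Qed.

Lemma trig_sum_nil : trig_sum [::] = fun=> 0.
Proof. by apply/funext => x; rewrite /trig_sum big_nil. Qed.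

Lemma trig_sum_cons c s :
  trig_sum (c :: s) = fun x => c.1 * wave c.2.1 c.2.2 x + trig_sum s x.
Proof. by apply/funext => x; rewrite /trig_sum big_cons. Qed.

Lemma trig_sum_le s x : `|trig_sum s x| <= amplitude s.
Proof.
apply: le_trans (ler_norm_sum _ _ _) _; apply: ler_sum => c _.
by rewrite normrM ler_piMr// wave_le1.
Qed.

Lemma trig_sum_continuous s : continuous (trig_sum s).
Proof.
elim: s => [|c s IH] x; first by rewrite trig_sum_nil; exact: cvg_cst.
rewrite trig_sum_cons; apply: cvgD; last exact: IH.
by apply: cvgM; [exact: cvg_cst|exact: wave_continuous].
Qed.

Lemma trig_sum_periodic s : torus_periodic (trig_sum s).
Proof. by move=> x y xy; apply: eq_bigr => c _; rewrite (wave_periodic _ _ xy). Qed.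

Lemma trig_sum_measurable s :
  measurable_fun setT
    (trig_sum s : measurableTypeR R * measurableTypeR R -> measurableTypeR R).
Proof.
elim: s => [|c s IH]; first by rewrite trig_sum_nil.
rewrite trig_sum_cons.
by apply: measurable_funD => //; apply: measurable_funM => //; exact: wave_measurable.
Qed.

Lemma fourier_trig_sum s k l : fourier (trig_sum s) k l =
  \sum_(c <- s) c.1 * fourier (wave c.2.1 c.2.2) k l.
Proof.
have int_ww (c : (int * int) * bool) : torus_measure.-integrable setT
    (EFin \o (fun x : R * R => wave c.1 c.2 x * wave k l x)).
  apply: (@bounded_torus_integrable _ _ 1).
    by apply: measurable_funM; exact: wave_measurable.
  by move=> x; rewrite normrM mulr_ile1// ?wave_le1.
have int_sw s' : torus_measure.-integrable setT
    (EFin \o (fun x : R * R => trig_sum s' x * wave k l x)).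
  apply: (@bounded_torus_integrable _ _ (amplitude s')).
    by apply: measurable_funM; [exact: trig_sum_measurable|exact: wave_measurable].
  move=> x; rewrite normrM (le_trans _ (trig_sum_le s' x))//.
  by rewrite ler_piMr// wave_le1.
rewrite /fourier; move: (4 * pi ^+ 2)^-1 => K; elim: s => [|c s IH].
  rewrite big_nil; rewrite trig_sum_nil; under eq_Rintegral do rewrite mul0r.
  by rewrite Rintegral_cst// mul0r mulr0.
rewrite big_cons -IH mulrCA -mulrDr; congr (_ * _).
rewrite -RintegralZl// -RintegralD//; last first.
  apply: (@bounded_torus_integrable _ _ `|c.1|).
    apply: measurable_funM => //.
    by apply: measurable_funM; exact: wave_measurable.
  by move=> x; rewrite !normrM ler_piMr// mulr_ile1// wave_le1.
by apply: eq_Rintegral => x _; rewrite trig_sum_cons mulrDl mulrA.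
Qed.

(** [wave_mul] splits the integrand into waves of frequencies [k - k'] and [k + k'], both nonzero.
    This part of orthogonality suffices, because a crude bound will do at [k] and [- k]. *)
Lemma fourier_wave0 k l k' l' : k' != k -> k' != - k ->
  fourier (wave k l : R * R -> R) k' l' = 0.
Proof.
move=> kk1 kk2; rewrite /fourier.
have iZ c m L : torus_measure.-integrable setT
    (EFin \o (fun x : R * R => c * wave m L x)).
  apply: (@bounded_torus_integrable _ _ `|c|).
    by apply: measurable_funM => //; exact: wave_measurable.
  by move=> x; rewrite normrM ler_piMr// wave_le1.
have i1 m L : torus_measure.-integrable setT (EFin \o (wave m L : R * R -> R)).
  apply: (@bounded_torus_integrable _ _ 1); first exact: wave_measurable.
  exact: wave_le1.
under eq_Rintegral do rewrite wave_mul.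
rewrite RintegralD// !RintegralZl// /Rintegral !integral_wave ?mulr0 ?addr0 ?mulr0//.
  by rewrite addrC -[k]opprK subr_eq0.
by rewrite subr_eq0 eq_sym.
Qed.

Lemma fourier_le f (B : R) k l :
  measurable_fun setT (f : measurableTypeR R * measurableTypeR R -> measurableTypeR R) ->
  (forall x, `|f x| <= B) -> `|fourier f k l| <= B.
Proof.
move=> mf fB; have fwB x : `|f x * wave k l x| <= B.
  by rewrite normrM (le_trans _ (fB x))// ler_piMr// wave_le1.
have fwi : torus_measure.-integrable setT (EFin \o (fun x => f x * wave k l x)).
  apply: (bounded_torus_integrable _ fwB).
  by apply: measurable_funM => //; exact: wave_measurable.
have p0 : 0 < 4 * pi ^+ 2 :> R by rewrite mulr_gt0// exprn_gt0// pi_gt0.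
rewrite /fourier normrM ger0_norm ?invr_ge0 ?(ltW p0)// mulrC ler_pdivrMr//.
apply: le_trans (le_normr_Rintegral _ fwi) _ => //.
have -> : B * (4 * pi ^+ 2) = Rintegral (torus_measure (R := R)) setT (cst B).
  by rewrite Rintegral_cst//; congr (_ * _); rewrite torus_measure_setT.
apply: le_Rintegral => //; first exact: integrable_norm fwi.
apply: (@bounded_torus_integrable _ _ `|B|) => //.
Qed.

End Waves.

(** * Bounds of the L^2 and H^5 norms by the amplitude *)

Section Norms.
Context {R : realType}.
Implicit Types (k : int * int) (l : bool) (f : R * R -> R).
Implicit Type s : seq (R * ((int * int) * bool)).

(** A real wave of frequency [k] has Fourier coefficients at [k] and at [- k], whence the negatives;
    the factor 2 counts cosine and sine coefficients. *)
Definition H5_weight (K : seq (int * int)) : R :=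
  \sum_(k <- undup (K ++ [seq - k | k <- K]))
    (1 + k.1%:~R ^+ 2 + k.2%:~R ^+ 2) ^+ 5 * 2.

(** The constant depends on the frequencies alone, so sums over a fixed list of frequencies tend to
    0 in H^5 as soon as their coefficients do. *)
Lemma H5_sqnorm_le s :
  (H5_sqnorm (trig_sum s) <= (H5_weight [seq c.2.1 | c <- s] * amplitude s ^+ 2)%:E)%E.
Proof.
set K := [seq c.2.1 | c <- s]; set S := undup (K ++ [seq - k | k <- K]).
pose w k : R := (1 + k.1%:~R ^+ 2 + k.2%:~R ^+ 2) ^+ 5.
have w0 k : 0 <= w k by rewrite exprn_ge0// !addr_ge0// sqr_ge0.
pose a k : \bar R := (w k * 2 * amplitude s ^+ 2)%:E.
have fourier0 k l : k \notin S -> fourier (trig_sum s) k l = 0.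
  rewrite mem_undup mem_cat negb_or => /andP[kK kNK].
  rewrite fourier_trig_sum big_seq big1// => c cs.
  have cK : c.2.1 \in K by apply/mapP; exists c.
  rewrite fourier_wave0 ?mulr0//.
    by apply: contraNneq kK => ->.
  by apply: contraNneq kNK => ->; apply/mapP; exists c.2.1.
have sq_le k l : fourier (trig_sum s) k l ^+ 2 <= amplitude s ^+ 2.
  rewrite -real_normK ?num_real// ler_sqr ?nnegrE ?amplitude_ge0//.
  by apply: fourier_le; [exact: trig_sum_measurable|exact: trig_sum_le].
apply: (@le_trans _ _ (\esum_(k in [set: int * int]) (if k \in [set` S] then a k else 0))%E).
  apply: le_esum => k _; rewrite mem_setE; case: ifPn => [_|kS].
    rewrite lee_fin [leRHS](_ : _ = w k * (amplitude s ^+ 2 + amplitude s ^+ 2)).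
      exact: ler_wpM2l (w0 k) _ _ (lerD (sq_le _ _) (sq_le _ _)).
    by ring.
  by rewrite !fourier0// expr0n addr0 mulr0.
rewrite -esum_mkcond esum_fset; first last.
- by move=> k _; rewrite lee_fin mulr_ge0// ?sqr_ge0// mulr_ge0.
- exact: finite_seq.
rewrite -fsbig_seq ?undup_uniq// sumEFin lee_fin /H5_weight -/K -/S mulr_suml.
exact: lexx.
Qed.

Lemma H5_sqnorm_ge0 f : (0 <= H5_sqnorm f)%E.
Proof.
apply: esum_ge0 => k _; rewrite lee_fin mulr_ge0 ?addr_ge0 ?sqr_ge0//.
by rewrite exprn_ge0// !addr_ge0// sqr_ge0.
Qed.

(** The factor [2 * pi] is the square root of the mass of the torus. *)
Lemma L2_norm_le f (B : R) :
  measurable_fun setT (f : measurableTypeR R * measurableTypeR R -> measurableTypeR R) ->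
  (forall x, `|f x| <= B) -> (L2_norm f <= (2 * pi * B)%:E)%E.
Proof.
move=> mf fB; have B0 : 0 <= B := le_trans (normr_ge0 _) (fB (0, 0)).
have p0 : 0 <= 2 * pi * B by rewrite !mulr_ge0// pi_ge0.
rewrite -(ger0_norm p0) -sqrtr_sqr -powR12_sqrt ?sqr_ge0//.
rewrite /L2_norm unlock.
rewrite -poweR_EFin; apply: gt0_ler_poweR => //.
- by rewrite in_itv/= leey andbT integral_ge0// => x _; exact: poweR_ge0.
- by rewrite in_itv/= leey andbT lee_fin sqr_ge0.
have -> : ((2 * pi * B) ^+ 2)%:E = (\int[torus_measure]_x (cst (B ^+ 2)%:E) x)%E.
  by rewrite integral_cst// torus_measure_setT -EFinM; congr EFin; ring.
apply: ge0_le_integral => //.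
- by move=> x _; exact: poweR_ge0.
- apply: (measurableT_comp (measurable_poweR 2)).
  by apply: measurableT_comp => //; apply/measurable_EFinP.

- move=> x _; rewrite /= lee_fin powR_mulrn// ler_sqr ?nnegrE//.
Qed.

Lemma L2_norm_ge0 f : (0 <= L2_norm f)%E.
Proof. exact: Lnorm_ge0. Qed.

Lemma cvge0_le (T : Type) (F : set_system T) {FF : ProperFilter F} (N : T -> \bar R)
    (h : T -> R) : (forall t, (0 <= N t <= (h t)%:E)%E) ->
  h t @[t --> F] --> 0 -> N t @[t --> F] --> 0%E.
Proof.
move=> Nh h0; apply: (@squeeze_cvge _ _ _ _ (fun=> 0%E) _ (EFin \o h)).
- by apply: nearW => t; exact: Nh.
- exact: cvg_cst.
- by apply: cvg_EFin => //; exact: nearW.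
Qed.

Lemma trig_sum_in_L2 s : in_L2 (trig_sum s).
Proof.
split; first exact: trig_sum_periodic.
apply/andP; split; rewrite inE/=.
  exact: trig_sum_measurable.
rewrite /finite_norm; apply: le_lt_trans (L2_norm_le (trig_sum_measurable s) (trig_sum_le s)) _.
exact: ltry.
Qed.

Lemma trig_sum_H5 s : H5 (trig_sum s).
Proof.
split; [exact: trig_sum_periodic|exact: trig_sum_continuous|].
exact: le_lt_trans (H5_sqnorm_le s) (ltry _).
Qed.

End Norms.

(** * Elementary coefficient functions on a normed space *)

Section Elementary.
Context {R : realType}.

(** Restricting to the line through [q] in direction [w] reduces directional derivatives to one real
    variable, where the chain rule [is_derive1_comp] applies. *)
Lemma is_derive_lineE (V W : normedModType R) (f : V -> W) q w df :
  is_derive q w f df <-> is_derive (0 : R) 1 (fun h : R => f (h *: w + q)) df.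
Proof.
have E : (fun h : R => h^-1 *: ((f \o shift q) (h *: w) - f q)) =
    (fun h : R => h^-1 *: (((fun h : R => f (h *: w + q)) \o shift (0 : R)) (h *: (1 : R))
      - f (0 *: w + q))).
  by apply/funext => h /=; rewrite addr0 scale0r add0r [h *: 1]mulr1.
by split; [case; rewrite /derivable /derive E|case; rewrite /derivable /derive -E];
  move=> D1 D2; constructor.
Qed.

Lemma is_derive_comp1 (V : normedModType R) (f : V -> R) (g : R -> R) q w df dg :
  is_derive q w f df -> is_derive (f q) 1 g dg ->
  is_derive q w (fun p => g (f p)) (dg * df).
Proof.
move=> /is_derive_lineE fD gD; apply/is_derive_lineE.
apply: (@is_derive1_comp _ g (fun h : R => f (h *: w + q))).
by rewrite scale0r add0r.
Qed.

(** A syntactic class closed under directional derivatives, so smoothness follows by iteration.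
    Polynomials in time come from the linear time coordinate; sine and cosine serve the phases of
    the moving waves. *)
Inductive elementary (E : normedModType R) : (E -> R) -> Prop :=
| elementary_linear (f : {linear E -> R^o}) : continuous f -> elementary f
| elementary_cst c : elementary (fun=> c)
| elementary_add f g : elementary f -> elementary g -> elementary (fun q => f q + g q)
| elementary_mul f g : elementary f -> elementary g -> elementary (fun q => f q * g q)
| elementary_cos f : elementary f -> elementary (fun q => cos (f q))
| elementary_sin f : elementary f -> elementary (fun q => sin (f q)).

Lemma elementary_continuous (E : normedModType R) (f : E -> R) :
  elementary f -> continuous f.
Proof.
elim=> {f} [f fC|c|f g _ fC _ gC|f g _ fC _ gC|f _ fC|f _ fC] x.
- exact: fC.
- exact: cvg_cst.
- by apply: cvgD; [exact: fC|exact: gC].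
- by apply: cvgM; [exact: fC|exact: gC].
- by apply: continuous_comp; [exact: fC|exact: continuous_cos].
- by apply: continuous_comp; [exact: fC|exact: continuous_sin].
Qed.

Lemma elementary_opp (E : normedModType R) (f : E -> R) :
  elementary f -> elementary (fun q => - f q).
Proof.
move=> ef; rewrite (_ : (fun _ => _) = fun q => -1 * f q).
  by apply: elementary_mul => //; exact: elementary_cst.
by apply/funext => q; rewrite mulN1r.
Qed.

Lemma is_derive_linear (E : normedModType R) (f : {linear E -> R^o}) q w :
  is_derive q w f (f w).
Proof.
apply/is_derive_lineE.
rewrite (_ : (fun _ => _) = fun h : R => h * f w + f q); last first.
  by apply/funext => h; rewrite linearD linearZ.
by apply: is_derive_eq; rewrite /GRing.scale/= ?mulr0 ?addr0 ?add0r ?mulr1.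
Qed.

Lemma elementary_exp (E : normedModType R) (f : E -> R) n :
  elementary f -> elementary (fun q => f q ^+ n).
Proof.
move=> ef; elim: n => [|n IH]; first exact: elementary_cst.
by under eq_fun do rewrite exprS; exact: elementary_mul.
Qed.

Lemma elementary_derive (E : normedModType R) (f : E -> R) w : elementary f ->
  exists2 f', elementary f' & forall q, is_derive q w f (f' q).
Proof.
elim=> {f} [f fC|c|f g ef [f' ef' fD] eg [g' eg' gD]
  |f g ef [f' ef' fD] eg [g' eg' gD]|f ef [f' ef' fD]|f ef [f' ef' fD]].
- by exists (fun=> f w) => [|q]; [exact: elementary_cst|exact: is_derive_linear].
- by exists (fun=> 0) => [|q]; [exact: elementary_cst|exact: is_derive_cst].
- by exists (fun q => f' q + g' q) => [|q]; [exact: elementary_add|exact: is_deriveD].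
- exists (fun q => f q * g' q + g q * f' q) => [|q].
    by apply: elementary_add; apply: elementary_mul.
  exact: is_deriveM.
- exists (fun q => - sin (f q) * f' q) => [|q].
    by apply: elementary_mul => //; apply: elementary_opp; exact: elementary_sin.
  exact: (is_derive_comp1 (fD q) (is_derive_cos _)).
- exists (fun q => cos (f q) * f' q) => [|q].
    by apply: elementary_mul => //; exact: elementary_cos.
  exact: (is_derive_comp1 (fD q) (is_derive_sin _)).
Qed.

(** Serves to freeze the end points of the trajectory and keep time as the only variable. *)
Lemma elementary_comp_affine (E E' : normedModType R) (L : {linear E' -> E}) (q : E)
    (f : E -> R) : continuous L ->
  elementary f -> elementary (fun p => f (q + L p)).
Proof.
move=> LC; elim=> {f} [f fC|c|f g _ IHf _ IHg|f g _ IHf _ IHg|f _ IH|f _ IH].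
- rewrite (_ : (fun _ => _) = fun p => f q + (f \o L) p).
    apply: elementary_add; first exact: elementary_cst.
    apply: (@elementary_linear _ (f \o L)) => x.
    by apply: continuous_comp; [exact: LC|exact: fC].
  by apply/funext => p; rewrite linearD.
- exact: elementary_cst.
- exact: elementary_add.
- exact: elementary_mul.
- exact: elementary_cos.
- exact: elementary_sin.
Qed.

End Elementary.

(** * Trigonometric polynomials with elementary coefficients *)

Section Trigpoly.
Context {R : realType} (E : normedModType R).
Implicit Types (k : int * int) (l : bool) (c : E -> R) (F G : E -> R * R -> R).

(** The frequencies are the same for all [q] and only the coefficients vary, so differences and
    difference quotients in [q] stay on one finite list of waves. *)
Inductive trigpoly : (E -> R * R -> R) -> Prop :=
| trigpoly0 : trigpoly (fun _ _ => 0)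
| trigpoly_cons c k l F : elementary c -> trigpoly F ->
    trigpoly (fun q y => c q * wave k l y + F q y).

Lemma trigpoly_monomial c k l : elementary c -> trigpoly (fun q y => c q * wave k l y).
Proof.
move=> ec; rewrite (_ : (fun _ _ => _) = fun q y => c q * wave k l y + 0).
  exact: (trigpoly_cons _ _ ec trigpoly0).
by apply/funext => q; apply/funext => y; rewrite addr0.
Qed.

Lemma trigpoly_add F G : trigpoly F -> trigpoly G ->
  trigpoly (fun q y => F q y + G q y).
Proof.
move=> tF tG; elim: tF => [|c k l F' ec _ IH].
  by under eq_fun do under eq_fun do rewrite add0r.
under eq_fun do under eq_fun do rewrite -addrA.
exact: trigpoly_cons.
Qed.

Lemma trigpoly_wave_mul k l F : trigpoly F -> trigpoly (fun q y => wave k l y * F q y).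
Proof.
elim=> [|c k' l' F' ec _ IH].
  by under eq_fun do under eq_fun do rewrite mulr0; exact: trigpoly0.
under eq_fun do under eq_fun do rewrite mulrDr mulrCA wave_mul mulrDr !mulrA.
by apply: trigpoly_add IH; apply: trigpoly_add; apply: trigpoly_monomial;
  repeat first [exact: elementary_cst|done|apply: elementary_mul].
Qed.

Lemma trigpoly_scale c F : elementary c -> trigpoly F -> trigpoly (fun q y => c q * F q y).
Proof.
move=> ec; elim=> [|c' k' l' F' ec' _ IH].
  by under eq_fun do under eq_fun do rewrite mulr0; exact: trigpoly0.
under eq_fun do under eq_fun do rewrite mulrDr mulrA.
by apply: trigpoly_cons IH; exact: elementary_mul.
Qed.

Lemma trigpoly_mul F G : trigpoly F -> trigpoly G ->
  trigpoly (fun q y => F q y * G q y).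
Proof.
move=> + tG; elim=> [|c k l F' ec _ IH].
  by under eq_fun do under eq_fun do rewrite mul0r; exact: trigpoly0.
under eq_fun do under eq_fun do rewrite mulrDl -mulrA.
by apply: trigpoly_add IH; apply: trigpoly_scale => //; exact: trigpoly_wave_mul.
Qed.

Lemma trigpoly_opp F : trigpoly F -> trigpoly (fun q y => - F q y).
Proof.
move=> tF; under eq_fun do under eq_fun do rewrite -mulN1r.
by apply: trigpoly_scale => //; exact: elementary_cst.
Qed.

Lemma trigpoly_derive F w : trigpoly F ->
  exists2 F', trigpoly F' & forall q y, is_derive q w (F^~ y) (F' q y).
Proof.
elim=> [|c k l F0 ec _ [F' tF' FD]].
  by exists (fun _ _ => 0) => [|q y]; [exact: trigpoly0|exact: is_derive_cst].
have [c' ec' cD] := elementary_derive w ec.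
exists (fun q y => c' q * wave k l y + F' q y) => [|q y]; first exact: trigpoly_cons.
have := cD q; have := FD q y => ? ?.
by apply: is_derive_eq; rewrite scaler0 add0r /GRing.scale/= mulrC.
Qed.

Definition axis (i : 'I_2) : R * R := if i == 0 then (1, 0) else (0, 1).

Lemma is_derive_wave k l (y v : R * R) : is_derive y v (wave k l)
  ((k.1%:~R * v.1 + k.2%:~R * v.2) * ((-1) ^+ (~~ l) * wave k (~~ l) y)).
Proof.
have D : is_derive y v (fun x : R * R => k.1%:~R * x.1 + k.2%:~R * x.2)
    (k.1%:~R * v.1 + k.2%:~R * v.2).
  apply/is_derive_lineE => /=; apply: is_derive_eq.
  by rewrite !(addr0, scaler0, add0r) /GRing.scale/= !mulr1.
rewrite mulrC /wave; case: l => /=; rewrite ?mul1r ?mulN1r.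
  exact: (is_derive_comp1 D (is_derive_sin _)).
exact: (is_derive_comp1 D (is_derive_cos _)).
Qed.

Lemma trigpoly_pderiv F v : trigpoly F ->
  exists2 F', trigpoly F' & forall q y, is_derive y v (F q) (F' q y).
Proof.
elim=> [|c k l F0 ec _ [F' tF' FD]].
  by exists (fun _ _ => 0) => [|q y]; [exact: trigpoly0|exact: is_derive_cst].
exists (fun q y => (c q * ((k.1%:~R * v.1 + k.2%:~R * v.2) * (-1) ^+ (~~ l))) *
    wave k (~~ l) y + F' q y) => [|q y].
  apply: trigpoly_cons => //; apply: elementary_mul => //; exact: elementary_cst.
have := FD q y; have := is_derive_wave k l y v => ? ?.
by apply: is_derive_eq; rewrite /GRing.scale/= !mulrA.
Qed.

End Trigpoly.

(** * Convergence and smoothness of trigonometric polynomials in L^2 and H^5 *)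

Section TrigpolyAnalysis.
Context {R : realType} (E : normedModType R).
Implicit Types (k : int * int) (l : bool) (c : E -> R) (F G : E -> R * R -> R).

Lemma trig_sum_map (s : seq nat) (d : nat -> R) (kl : nat -> (int * int) * bool) y :
  trig_sum [seq (d i, kl i) | i <- s] y = \sum_(i <- s) d i * wave (kl i).1 (kl i).2 y.
Proof. by rewrite /trig_sum big_map. Qed.

Lemma trig_sum_cvg0 (T : Type) (Fl : set_system T) {FF : ProperFilter Fl}
    (s : seq nat) (d : nat -> T -> R) (kl : nat -> (int * int) * bool) :
  (forall i, d i t @[t --> Fl] --> 0) ->
  L2_norm (trig_sum [seq (d i t, kl i) | i <- s]) @[t --> Fl] --> 0%E /\
  H5_sqnorm (trig_sum [seq (d i t, kl i) | i <- s]) @[t --> Fl] --> 0%E.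
Proof.
move=> d0.
have a0 : amplitude [seq (d i t, kl i) | i <- s] @[t --> Fl] --> (0 : R).
  rewrite /amplitude; under eq_fun do rewrite big_map.
  elim: s => [|i s IH]; first by under eq_fun do rewrite big_nil; exact: cvg_cst.
  under eq_fun do rewrite big_cons.
  have := cvgD (cvg_norm (d0 i)) IH; rewrite normr0 addr0; apply.
split.
  apply: (@cvge0_le _ _ _ _ _ (fun t => 2 * pi * amplitude [seq (d i t, kl i) | i <- s])).
    move=> t; rewrite L2_norm_ge0; apply: L2_norm_le.
      exact: trig_sum_measurable.
    exact: trig_sum_le.
  have := cvgM (cvg_cst (2 * pi)) a0; rewrite mulr0; apply.
apply: (@cvge0_le _ _ _ _ _ (fun t => H5_weight [seq (kl i).1 | i <- s]
    * amplitude [seq (d i t, kl i) | i <- s] ^+ 2)).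
  move=> t; rewrite H5_sqnorm_ge0; apply: le_trans (H5_sqnorm_le _) _.
  by rewrite -map_comp.
have := cvgM (cvg_cst (H5_weight [seq (kl i).1 | i <- s])) (cvgM a0 a0).
rewrite !mulr0; apply.
Qed.

Lemma trigpolyP F : trigpoly F -> exists n (c : nat -> E -> R) (kl : nat -> (int * int) * bool),
  (forall i, elementary (c i)) /\
  F = fun q => trig_sum [seq (c i q, kl i) | i <- iota 0 n].
Proof.
elim=> [|c k l F0 ec _ [n [c0 [kl [ec0 ->]]]]].
  exists 0%N, (fun _ _ => 0), (fun=> (0, false)); split; first by move=> i; exact: elementary_cst.
  by apply/funext => q; rewrite trig_sum_nil.
exists n.+1, (fun i => if i is j.+1 then c0 j else c), (fun i => if i is j.+1 then kl j else (k, l)).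
split; first by case.
apply/funext => q; apply/funext => y.
by rewrite /= trig_sum_cons/= (iotaDl 1) -map_comp.
Qed.

Lemma trigpoly_in_L2 F q : trigpoly F -> in_L2 (F q).
Proof. by case/trigpolyP => n [c [kl [_ ->]]]; exact: trig_sum_in_L2. Qed.

Lemma trigpoly_H5 F q : trigpoly F -> H5 (F q).
Proof. by case/trigpolyP => n [c [kl [_ ->]]]; exact: trig_sum_H5. Qed.

Lemma trigpoly_cvg F q : trigpoly F ->
  L2_norm (fun y => F q' y - F q y) @[q' --> q] --> 0%E /\
  H5_sqnorm (fun y => F q' y - F q y) @[q' --> q] --> 0%E.
Proof.
case/trigpolyP => n [c [kl [ec ->]]].
have D q' : (fun y => trig_sum [seq (c i q', kl i) | i <- iota 0 n] y -
    trig_sum [seq (c i q, kl i) | i <- iota 0 n] y) =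
    trig_sum [seq (c i q' - c i q, kl i) | i <- iota 0 n].
  apply/funext => y; rewrite !trig_sum_map -sumrB.
  by apply: eq_bigr => i _; rewrite mulrBl.
have d0 i : c i q' - c i q @[q' --> q] --> (0 : R).
  rewrite -(subrr (c i q)).
  by apply: cvgB; [exact: elementary_continuous|exact: cvg_cst].
have [L0 H0] := trig_sum_cvg0 (iota 0 n) kl d0.
by split; under eq_fun do rewrite D.
Qed.

Lemma trigpoly_quotient F (F' : R * R -> R) q w : trigpoly F ->
  (forall y, is_derive q w (F^~ y) (F' y)) ->
  L2_norm (fun y => e^-1 * (F (q + e *: w) y - F q y) - F' y) @[e --> 0^'] --> 0%E.
Proof.
case/trigpolyP => n [c [kl [ec ->]]] FD.
have cD i := elementary_derive w (ec i).
(* [F'] is given only as a pointwise derivative; uniqueness of derivatives identifies it with the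
   sum that has the differentiated coefficients. *)
have F'E y : F' y = \sum_(i <- iota 0 n) 'D_w (c i) q * wave (kl i).1 (kl i).2 y.
  rewrite -(@derive_val _ _ _ _ _ _ _ (FD y)).
  under eq_fun do rewrite trig_sum_map.
  apply: @derive_val; elim: (iota 0 n) => [|i s IH].
    by under eq_fun do rewrite big_nil; rewrite big_nil; exact: is_derive_cst.
  under eq_fun do rewrite big_cons; rewrite big_cons.
  have [c' ec' c'D] := cD i; have Di := c'D q.
  by apply: is_derive_eq; rewrite derive_val scaler0 add0r /GRing.scale/= mulrC.
have D e : (fun y => e^-1 * (trig_sum [seq (c i (q + e *: w), kl i) | i <- iota 0 n] y -
      trig_sum [seq (c i q, kl i) | i <- iota 0 n] y) - F' y) =
    trig_sum [seq (e^-1 * (c i (q + e *: w) - c i q) - 'D_w (c i) q, kl i) | i <- iota 0 n].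
  apply/funext => y; rewrite !trig_sum_map F'E -sumrB mulr_sumr -sumrB.
  by apply: eq_bigr => i _; ring.
under eq_fun do rewrite D; apply: (proj1 (trig_sum_cvg0 _ _ _)) => i.
have [c' ec' c'D] := cD i; have Di := c'D q.
have := cvgB (@ex_derive _ _ _ _ _ _ _ Di) (cvg_cst ('D_w (c i) q)).
rewrite subrr; move/(_ _ _); apply: cvg_trans; apply: near_eq_cvg.
by apply: nearW => e /=; rewrite [q + _]addrC.
Qed.

Lemma trigpoly_smooth_L2 F (D : set E) : trigpoly F -> smooth_L2 D F.
Proof.
move=> tF.
(* The head of the list is the direction differentiated last, as [w :: s] in [smooth_L2] prescribes.
   Each [G s] is again a [trigpoly], and its limits over full neighbourhoods restrict to [D]. *)
pose G := fix G (s : seq E) : E -> R * R -> R :=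
  if s is w :: s' then fun q y => 'D_w ((G s')^~ y) q else F.
have step F0 w : trigpoly F0 -> trigpoly (fun q y => 'D_w (F0^~ y) q) /\
    forall q y, is_derive q w (F0^~ y) ('D_w (F0^~ y) q).
  move=> /(trigpoly_derive w)[F' tF' FD].
  have FE q y : 'D_w (F0^~ y) q = F' q y by have := FD q y => ?; exact: derive_val.
  split=> [|q y]; last by rewrite FE.
  by under eq_fun do under eq_fun do rewrite FE.
have tG s : trigpoly (G s) by elim: s => //= w s IH; exact: (step _ _ IH).1.
exists G; split=> [//|s q _|s q _|s w q _].
- exact: trigpoly_in_L2.
- apply: cvg_trans (trigpoly_cvg q (tG s)).1; apply: cvg_app; exact: cvg_within.
- apply: (@cvg_trans _ (L2_norm (fun y => e^-1 * (G s (q + e *: w) y - G s q y) -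
      G (w :: s) q y) @[e --> 0^'])); first by apply: cvg_app; exact: cvg_within.
  by apply: trigpoly_quotient => // y; exact: (step _ _ (tG s)).2.
Qed.

Lemma trigpoly_comp_affine (E' : normedModType R) (L : {linear E' -> E}) (q : E) F :
  continuous L -> trigpoly F -> trigpoly (fun p => F (q + L p)).
Proof.
move=> LC; elim=> [|c k l F0 ec _ IH]; first exact: trigpoly0.
by apply: trigpoly_cons IH; exact: elementary_comp_affine.
Qed.

End TrigpolyAnalysis.

Section TrigpolyCurve.
Context {R : realType}.

Lemma trigpoly_H5_curve (F : R^o -> R * R -> R) (I : set R) :
  trigpoly F -> H5_curve I F.
Proof.
move=> tF; split=> t _; first exact: trigpoly_H5.
have [_ H] := trigpoly_cvg (t : R^o) tF; apply: cvg_trans H.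
by apply: cvg_app; exact: cvg_within.
Qed.

Lemma trigpoly_L2_derivative (F : R^o -> R * R -> R) (F' : R * R -> R) (I : set R) (t : R) :
  trigpoly F -> (forall y, is_derive t (1 : R) (F^~ y) (F' y)) -> L2_derivative I F t F'.
Proof.
move=> tF FD; have Q := trigpoly_quotient tF FD.
apply: (@cvg_trans _ (L2_norm (fun y => (s - t)^-1 * (F s y - F t y) - F' y) @[s --> t^'])).
  by apply: cvg_app; exact: cvg_within.
(* The increment [s - t] carries the punctured neighbourhoods of [t] to those of 0, which turns the
   quotient in [e] into that of [L2_derivative]. *)
have st : s - t @[s --> t^'] --> (0 : R)^'.
  have : s - t @[s --> t] --> (0 : R).
    by rewrite -(subrr t); apply: cvgB; [exact: cvg_id|exact: cvg_cst].
  move=> h A A0.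
  have hA : \forall s \near t, s - t != 0 -> A (s - t) := h _ A0.
  have : \forall s \near t^', A (s - t).
    near=> s; have st : s - t != 0.
      by rewrite subr_eq0; near: s; exact: nbhs_dnbhs_neq.
    by move: st; near: s; exact: nbhs_dnbhs hA.
  by [].
have := cvg_comp _ _ st Q; apply: cvg_trans; apply: near_eq_cvg.
apply: nearW => s /=; congr L2_norm; apply/funext => y.
by rewrite [_ *: _]mulr1 [t + _]addrC subrK.
Unshelve. all: by end_near. Qed.

End TrigpolyCurve.

(** * Plane waves with a moving centre *)

Section PlaneWave.
Context {R : realType}.
Implicit Types (k : int * int) (y v : R * R).

(** A wave centred where the phase equals [chi]: there [A] is its value and [B] its derivative in
    the phase. Differentiation in the phase sends [(A, B)] to [(B, - A)]. *)
Definition plane k (A B chi : R) y : R :=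
  let xi := k.1%:~R * y.1 + k.2%:~R * y.2 - chi in A * cos xi + B * sin xi.

Lemma is_derive_plane_space k A B chi y v :
  is_derive y v (plane k A B chi)
    ((k.1%:~R * v.1 + k.2%:~R * v.2) * plane k B (- A) chi y).
Proof.
apply/is_derive_lineE; rewrite /plane /=; apply: is_derive_eq.
rewrite !(scale0r, add0r, addr0, scaler0, subr0) /GRing.scale/= !mulr1.
by ring.
Qed.

(** Moving the centre at speed [chi'] subtracts [chi'] times the phase derivative [(B, - A)] from
    [(A', B')]. *)
Lemma is_derive_plane_param (E : normedModType R) (q w : E) k (A B chi : E -> R) A' B' chi' y :
  is_derive q w A A' -> is_derive q w B B' -> is_derive q w chi chi' ->
  is_derive q w (fun r => plane k (A r) (B r) (chi r) y)
    (plane k (A' - chi' * B q) (B' + chi' * A q) (chi q) y).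
Proof.
move=> dA dB dchi; rewrite /plane.
set f := (fun r => k.1%:~R * y.1 + k.2%:~R * y.2 - chi r).
have df : is_derive q w f (- chi').
  by rewrite /f; apply: is_derive_eq; rewrite add0r.
have dc := is_derive_comp1 df (is_derive_cos (f q)).
have ds := is_derive_comp1 df (is_derive_sin (f q)).
by apply: is_derive_eq; rewrite /f /GRing.scale/=; ring.
Qed.

Lemma trigpoly_plane (E : normedModType R) k (A B chi : E -> R) :
  elementary A -> elementary B -> elementary chi ->
  trigpoly (fun q y => plane k (A q) (B q) (chi q) y).
Proof.
move=> eA eB echi.
rewrite (_ : (fun _ _ => _) = fun q y =>
    (A q * cos (chi q) + - (B q * sin (chi q))) * wave k false y +
    (A q * sin (chi q) + B q * cos (chi q)) * wave k true y).
  apply: trigpoly_add; apply: trigpoly_monomial; apply: elementary_add;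
    try apply: elementary_opp; apply: elementary_mul => //;
    by [apply: elementary_cos|apply: elementary_sin].
apply/funext => q; apply/funext => y; rewrite /plane /wave /=.
move: (_ + _ * y.2) => z; rewrite cosB sinB; ring.
Qed.

Lemma pderivE i (f : R * R -> R) y df : is_derive y (axis i) f df -> pderiv i f y = df.
Proof. by move=> D; exact: derive_val. Qed.

Lemma sum2E (f : 'I_2 -> R) : \sum_i f i = f 0 + f 1.
Proof. by rewrite !big_ord_recl big_ord0 addr0; congr (f _ + f _); exact: val_inj. Qed.

End PlaneWave.

(** * The two-shear flow along a given trajectory *)

Section Flow.
Context {R : realType} (nu g : R) (E : normedModType R).
(* Position, velocity and acceleration of the trajectory, angular velocity and
   angular acceleration of the direction, as functions of a parameter. *)
Context (x1 x2 v1 v2 w1 w2 om al : E -> R).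
Implicit Types (q w : E) (y : R * R).

(** On the trajectory the shears take the values [a] and [b], so the velocity there is
    [(b - a, b + a)]; [c] is their common phase derivative, each shear supplying half of the angular
    velocity. The phases [chi1] and [chi2] move at speeds [2 * b] and [- 2 * a]. *)
Let a q := (v2 q - v1 q) / 2.
Let b q := (v1 q + v2 q) / 2.
Let c q := om q / 2.
Let da q := (w2 q - w1 q) / 2.
Let db q := (w1 q + w2 q) / 2.
Let dc q := al q / 2.
Let chi1 q := x1 q + x2 q.
Let chi2 q := x1 q - x2 q.

(* The primes are derivatives in the phase. *)
Definition shear1 q := plane (1, 1) (a q) (c q) (chi1 q).
Definition shear1' q := plane (1, 1) (c q) (- a q) (chi1 q).
Definition shear2 q := plane (1, -1) (b q) (c q) (chi2 q).
Definition shear2' q := plane (1, -1) (c q) (- b q) (chi2 q).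

(* The time derivative minus nu times the Laplacian, applied to the two
   shears, is plane (1, 1) A1 C1 and plane (1, -1) B2 D2. *)
Let A1 q := da q - 2 * b q * c q + 2 * nu * a q.
Let C1 q := dc q + 2 * a q * b q + 2 * nu * c q.
Let B2 q := db q + 2 * a q * c q + 2 * nu * b q.
Let D2 q := dc q - 2 * a q * b q + 2 * nu * c q.

Definition flow_velocity q (j : 'I_2) y :=
  if j == 0 then shear2 q y - shear1 q y else shear2 q y + shear1 q y.

(** The product cancels the horizontal advection. The two waves are, up to sign, phase
    antiderivatives of the linear terms, with signs chosen so that the horizontal derivative cancels
    these as well. *)
Definition flow_pressure q y :=
  2 * (shear1 q y * shear2 q y)
  + plane (1, -1) (D2 q) (- B2 q) (chi2 q) y
  + plane (1, 1) (- C1 q) (A1 q) (chi1 q) y.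

(** The remainder of the vertical equation, divided by [g]. The signs that make the pressure cancel
    every horizontal term make it double the vertical ones: hence 2 for the linear terms and 4 for
    the advection. *)
Definition flow_temperature q y := g^-1 *
  (2 * (plane (1, 1) (A1 q) (C1 q) (chi1 q) y + plane (1, -1) (B2 q) (D2 q) (chi2 q) y)
   + 4 * (shear2 q y * shear1' q y - shear1 q y * shear2' q y)).

Lemma pderiv_shear1 i q y : is_derive y (axis i) (shear1 q) (shear1' q y).
Proof.
have := is_derive_plane_space (1, 1) (a q) (c q) (chi1 q) y (axis i).
rewrite /axis; case: ifP => _ /=; rewrite !(mulr0, mulr1, addr0, add0r) mul1r;
  exact.
Qed.

Lemma pderiv_shear2 i q y :
  is_derive y (axis i) (shear2 q) ((if i == 0 then 1 else -1) * shear2' q y).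
Proof.
have := is_derive_plane_space (1, -1) (b q) (c q) (chi2 q) y (axis i).
rewrite /axis; case: ifP => _ /=; rewrite !(mulr0, mulr1, addr0, add0r); exact.
Qed.

Lemma pderiv_velocity i j q y : pderiv i (flow_velocity q j) y =
  if j == 0 then (if i == 0 then 1 else -1) * shear2' q y - shear1' q y
  else (if i == 0 then 1 else -1) * shear2' q y + shear1' q y.
Proof.
have D1 := pderiv_shear1 i q y; have D2' := pderiv_shear2 i q y.
by apply: pderivE; rewrite /flow_velocity; case: ifP => _; apply: is_derive_eq.
Qed.

(** Both frequencies have squared length 2. *)
Lemma laplacian_velocity j q y :
  laplacian (flow_velocity q j) y = - 2 * flow_velocity q j y.
Proof.
have H i : pderiv i (pderiv i (flow_velocity q j)) y = - flow_velocity q j y.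
  have D1 := is_derive_plane_space (1, 1) (c q) (- a q) (chi1 q) y (axis i).
  have D2' := is_derive_plane_space (1, -1) (c q) (- b q) (chi2 q) y (axis i).
  rewrite (funext (pderiv_velocity i j q)).
  apply: pderivE; rewrite /flow_velocity /shear1' /shear2'.
  by case: (j == 0); apply: is_derive_eq; rewrite /axis /shear1 /shear2 /plane;
    case: (i == 0) => /=; rewrite ?scaler0 /GRing.scale/=; ring.
by rewrite /laplacian sum2E !H; ring.
Qed.

Lemma flow_incompressible q y : divergence (flow_velocity q) y = 0.
Proof. by rewrite /divergence sum2E !pderiv_velocity/=; ring. Qed.

Lemma flow_velocity_at q j : flow_velocity q j (x1 q, x2 q) = if j == 0 then v1 q else v2 q.
Proof.
rewrite /flow_velocity /shear1 /shear2 /plane /=.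
have -> : 1 * x1 q + 1 * x2 q - chi1 q = 0 by rewrite /chi1; ring.
have -> : 1 * x1 q + -1 * x2 q - chi2 q = 0 by rewrite /chi2; ring.
by rewrite cos0 sin0; case: ifP => _; rewrite /a /b; field.
Qed.

(** The phase derivatives of the two shears agree on the trajectory, so the strain cancels and the
    rotations add up. *)
Lemma flow_gradient_at q i j : velocity_grad (flow_velocity q) (x1 q, x2 q) i j =
  if i == j then 0 else if i == 0 then om q else - om q.
Proof.
rewrite mxE pderiv_velocity /shear1' /shear2' /plane /=.
have -> : 1 * x1 q + 1 * x2 q - chi1 q = 0 by rewrite /chi1; ring.
have -> : 1 * x1 q + -1 * x2 q - chi2 q = 0 by rewrite /chi2; ring.
rewrite cos0 sin0 /c.
by case: i j => -[|[|//]] ? [[|[|//]] ?] /=; field.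
Qed.

Lemma pderiv_pressure j q y : pderiv j (flow_pressure q) y =
  if j == 0 then
    2 * (shear1' q y * shear2 q y + shear1 q y * shear2' q y)
    + plane (1, 1) (A1 q) (C1 q) (chi1 q) y - plane (1, -1) (B2 q) (D2 q) (chi2 q) y
  else
    2 * (shear1' q y * shear2 q y - shear1 q y * shear2' q y)
    + plane (1, 1) (A1 q) (C1 q) (chi1 q) y + plane (1, -1) (B2 q) (D2 q) (chi2 q) y.
Proof.
have d1 := pderiv_shear1 j q y; have d2 := pderiv_shear2 j q y.
have d3 := is_derive_plane_space (1, -1) (D2 q) (- B2 q) (chi2 q) y (axis j).
have d4 := is_derive_plane_space (1, 1) (- C1 q) (A1 q) (chi1 q) y (axis j).
apply: pderivE; rewrite /flow_pressure; apply: is_derive_eq.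
rewrite /axis; case: ifP => _ /=; rewrite ?scaler0 /GRing.scale/= /plane; ring.
Qed.

Section Time.
Context (w : E).
Hypotheses (x1D : forall q, is_derive q w x1 (v1 q))
  (x2D : forall q, is_derive q w x2 (v2 q))
  (v1D : forall q, is_derive q w v1 (w1 q))
  (v2D : forall q, is_derive q w v2 (w2 q))
  (omD : forall q, is_derive q w om (al q)) (g0 : g != 0).

Lemma flow_momentum q j y : is_derive q w (fun r => flow_velocity r j y)
  (- advection (flow_velocity q) (flow_velocity q j) y - pderiv j (flow_pressure q) y
   + nu * laplacian (flow_velocity q j) y + gravity g j * flow_temperature q y).
Proof.
have aD : is_derive q w a (da q).
  have ? := v1D q; have ? := v2D q.
  by apply: is_derive_eq; rewrite /GRing.scale/= /da; field.
have bD : is_derive q w b (db q).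
  have ? := v1D q; have ? := v2D q.
  by apply: is_derive_eq; rewrite /GRing.scale/= /db; field.
have cD : is_derive q w c (dc q).
  have ? := omD q.
  by apply: is_derive_eq; rewrite /GRing.scale/= /dc; field.
have chi1D : is_derive q w chi1 (2 * b q).
  have ? := x1D q; have ? := x2D q.
  by apply: is_derive_eq; rewrite /b; field.
have chi2D : is_derive q w chi2 (- 2 * a q).
  have ? := x1D q; have ? := x2D q.
  by apply: is_derive_eq; rewrite /a; field.
have d1 := is_derive_plane_param (1, 1) y aD cD chi1D.
have d2 := is_derive_plane_param (1, -1) y bD cD chi2D.
rewrite laplacian_velocity pderiv_pressure /advection sum2E !pderiv_velocity.
rewrite /gravity /flow_velocity /flow_temperature /shear1 /shear2.
(* The horizontal identity involves no temperature and is polynomial in the sines and cosines; the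
   vertical one also needs [g0] to cancel [g^-1]. *)
case: ifP => _; apply: is_derive_eq;
  rewrite /= /shear1 /shear2 /shear1' /shear2' /A1 /B2 /C1 /D2 /plane.
  by ring.
by field.
Qed.

End Time.

Lemma trigpoly_flow_velocity j :
  elementary x1 -> elementary x2 -> elementary v1 -> elementary v2 -> elementary om ->
  trigpoly (fun q => flow_velocity q j).
Proof.
move=> *; rewrite /flow_velocity; case: (j == 0) => /=; apply: trigpoly_add; try apply: trigpoly_opp;
  apply: trigpoly_plane; repeat first [done|exact: elementary_cst
    |apply: elementary_mul|apply: elementary_add|apply: elementary_opp].
Qed.

Lemma trigpoly_flow_pressure :
  elementary x1 -> elementary x2 -> elementary v1 -> elementary v2 ->
  elementary w1 -> elementary w2 -> elementary om -> elementary al ->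
  trigpoly flow_pressure.
Proof.
move=> *; apply: trigpoly_add; first apply: trigpoly_add;
  first (apply: trigpoly_scale; [exact: elementary_cst|apply: trigpoly_mul]);
  apply: trigpoly_plane; repeat first [done|exact: elementary_cst
    |apply: elementary_mul|apply: elementary_add|apply: elementary_opp].
Qed.

Lemma trigpoly_flow_temperature :
  elementary x1 -> elementary x2 -> elementary v1 -> elementary v2 ->
  elementary w1 -> elementary w2 -> elementary om -> elementary al ->
  trigpoly flow_temperature.
Proof.
move=> *; apply: trigpoly_scale; first exact: elementary_cst.
apply: trigpoly_add; apply: trigpoly_scale; try exact: elementary_cst;
  apply: trigpoly_add; try apply: trigpoly_opp; try apply: trigpoly_mul;
  apply: trigpoly_plane; repeat first [done|exact: elementary_cst
    |apply: elementary_mul|apply: elementary_add|apply: elementary_opp].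
Qed.

End Flow.

(** * Paths between two configurations, as functions of end points and time *)

Section Steering.
Context {R : realType} (nu1 nu2 g : R).
Hypothesis g0 : g != 0.

Local Notation config := (@lifted_config R).
Local Notation E := (config * config * R^o)%type.
Implicit Types (q w : E) (y : R * R).

(* step' and step'' vanish at 0 and 1, hence so do the velocity and the
   temperature of the flow. *)
Definition step (t : R) : R := 10 * t ^+ 3 - 15 * t ^+ 4 + 6 * t ^+ 5.
Definition step' (t : R) : R := 30 * t ^+ 2 - 60 * t ^+ 3 + 30 * t ^+ 4.
Definition step'' (t : R) : R := 60 * t - 180 * t ^+ 2 + 120 * t ^+ 3.

Lemma is_derive_step (t : R) : is_derive t (1 : R) step (step' t).
Proof. by apply: is_derive_eq; rewrite /GRing.scale/= /step'; ring. Qed.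

Lemma is_derive_step' (t : R) : is_derive t (1 : R) step' (step'' t).
Proof. by apply: is_derive_eq; rewrite /GRing.scale/= /step''; ring. Qed.

Definition time_axis : E := (0, 0, 1).

(** Here [pi] is a coordinate of a configuration, not the number; [q] collects the initial
    configuration, the final one and the time. *)
Definition start (pi : config -> R^o) q : R := pi q.1.1.
Definition target (pi : config -> R^o) q : R := pi q.1.2.
(** With [step], [step'] and [step''] for [f], this is the displacement, the velocity and the
    acceleration along a straight path in lifted coordinates. *)
Definition rate (f : R -> R) (pi : config -> R^o) q : R := f q.2 * (target pi q - start pi q).
Definition interp (pi : config -> R^o) q : R := start pi q + rate step pi q.

Lemma elementary_start (pi : {linear config -> R^o}) :
  continuous pi -> elementary (start pi).
Proof.
move=> piC; apply: (@elementary_linear _ _ (pi \o fst \o fst)) => x /=.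
apply: (@continuous_comp _ _ _ (fun q : E => q.1.1) pi); last exact: piC.
by apply: (@continuous_comp _ _ _ (fun q : E => q.1) fst); exact: cvg_fst.
Qed.

Lemma elementary_target (pi : {linear config -> R^o}) :
  continuous pi -> elementary (target pi).
Proof.
move=> piC; apply: (@elementary_linear _ _ (pi \o snd \o fst)) => x /=.
apply: (@continuous_comp _ _ _ (fun q : E => q.1.2) pi); last exact: piC.
by apply: (@continuous_comp _ _ _ (fun q : E => q.1) snd); [exact: cvg_fst|exact: cvg_snd].
Qed.

Lemma elementary_time : elementary (fun q => (q.2 : R)).
Proof. by apply: (@elementary_linear _ _ snd) => x; exact: cvg_snd. Qed.

Lemma is_derive_time q : is_derive q time_axis (fun q => (q.2 : R)) 1.
Proof. exact: (@is_derive_linear _ _ snd). Qed.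

Lemma elementary_rate (f : R -> R) (pi : {linear config -> R^o}) : continuous pi ->
  elementary (fun q => f q.2) -> elementary (rate f pi).
Proof.
move=> piC ef; apply: elementary_mul => //; apply: elementary_add.
  exact: elementary_target.
by apply: elementary_opp; exact: elementary_start.
Qed.

Lemma elementary_interp (pi : {linear config -> R^o}) : continuous pi ->
  elementary (fun q => step q.2) -> elementary (interp pi).
Proof.
by move=> piC es; apply: elementary_add; [exact: elementary_start|exact: elementary_rate].
Qed.

Lemma elementary_steps : [/\ elementary (fun q => step q.2),
  elementary (fun q => step' q.2) & elementary (fun q => step'' q.2)].
Proof.
by split; rewrite /step /step' /step''; repeat first [exact: elementary_cst
  |exact: elementary_time|apply: elementary_exp|apply: elementary_add
  |apply: elementary_opp|apply: elementary_mul].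
Qed.

Lemma is_derive_rate (f f' : R -> R) (pi : {linear config -> R^o}) q :
  (forall t, is_derive t (1 : R) f (f' t)) ->
  is_derive q time_axis (rate f pi) (rate f' pi q).
Proof.
move=> fD; have sD : is_derive q time_axis (start pi) 0.
  by rewrite -(linear0 pi); exact: (@is_derive_linear _ _ (pi \o fst \o fst)).
have tD : is_derive q time_axis (target pi) 0.
  by rewrite -(linear0 pi); exact: (@is_derive_linear _ _ (pi \o snd \o fst)).
have fqD := is_derive_comp1 (is_derive_time q) (fD q.2).
apply: is_derive_eq.
by rewrite subrr scaler0 add0r /GRing.scale/= mulr1 mulrC.
Qed.

Lemma is_derive_interp (pi : {linear config -> R^o}) q :
  is_derive q time_axis (interp pi) (rate step' pi q).
Proof.
have sD : is_derive q time_axis (start pi) 0.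
  by rewrite -(linear0 pi); exact: (@is_derive_linear _ _ (pi \o fst \o fst)).
have rD := is_derive_rate pi q is_derive_step.
by apply: is_derive_eq; rewrite add0r.
Qed.

(** The end points stay fixed along [time_axis], so identities on the whole parameter space become
    time derivatives at given end points. *)
Lemma slice_derive (f : E -> R) (q0 q1 : config) (t df : R) :
  is_derive ((q0, q1, t) : E) time_axis f df ->
  is_derive t (1 : R) (fun s : R => f (q0, q1, s)) df.
Proof.
move/is_derive_lineE => D; apply/is_derive_lineE.
rewrite (_ : (fun _ => _) = fun h : R => f (h *: time_axis + (q0, q1, t))) //.
apply/funext => h; congr f.
have -> : h *: time_axis + (q0, q1, t) =
  (h *: 0 + q0, h *: 0 + q1, h *: (1 : R^o) + t) by [].
by rewrite !scaler0 !add0r.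
Qed.

End Steering.

(** * The steering control and the solution that it produces *)

Section Control.
Context {R : realType} (nu1 nu2 g : R).
Hypothesis g0 : g != 0.

Local Notation config := (@lifted_config R).
Local Notation E := (config * config * R^o)%type.
Implicit Types (q w : E) (y : R * R).

Let c1 : {linear config -> R^o} := fst \o fst.
Let c2 : {linear config -> R^o} := snd \o fst.
Let c3 : {linear config -> R^o} := snd.

Let c1C : continuous c1.
Proof. by move=> x; apply: (@continuous_comp _ _ _ fst fst); exact: cvg_fst. Qed.

Let c2C : continuous c2.
Proof. by move=> x; apply: (@continuous_comp _ _ _ fst snd); [exact: cvg_fst|exact: cvg_snd]. Qed.

Let c3C : continuous c3.
Proof. by move=> x; exact: cvg_snd. Qed.

Definition steering_velocity : E -> 'I_2 -> R * R -> R :=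
  flow_velocity (interp c1) (interp c2) (rate step' c1) (rate step' c2) (rate step' c3).

Definition steering_pressure : E -> R * R -> R :=
  flow_pressure nu1 (interp c1) (interp c2) (rate step' c1) (rate step' c2)
    (rate step'' c1) (rate step'' c2) (rate step' c3) (rate step'' c3).

Definition steering_temperature : E -> R * R -> R :=
  flow_temperature nu1 g (interp c1) (interp c2) (rate step' c1) (rate step' c2)
    (rate step'' c1) (rate step'' c2) (rate step' c3) (rate step'' c3).

Definition steering_forcing q y : R :=
  'D_time_axis (steering_temperature^~ y) q
  + advection (steering_velocity q) (steering_temperature q) y
  - nu2 * laplacian (steering_temperature q) y.

Lemma trigpoly_steering :
  [/\ forall j, trigpoly (fun q => steering_velocity q j), trigpoly steering_pressure
    & trigpoly steering_temperature].
Proof.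
have [s0 s1 s2] := @elementary_steps R.
have i1 := elementary_interp c1C s0; have i2 := elementary_interp c2C s0.
have r1 := elementary_rate c1C s1; have r2 := elementary_rate c2C s1.
have r3 := elementary_rate c3C s1.
have a1 := elementary_rate c1C s2; have a2 := elementary_rate c2C s2.
have a3 := elementary_rate c3C s2.
split=> [j||]; first exact: trigpoly_flow_velocity.
  exact: trigpoly_flow_pressure.
exact: trigpoly_flow_temperature.
Qed.

Lemma trigpoly_pderivE (i : 'I_2) (F : E -> R * R -> R) :
  trigpoly F -> trigpoly (fun q => pderiv i (F q)).
Proof.
move=> /(trigpoly_pderiv (axis i))[F' tF' FD].
by rewrite (_ : (fun q => _) = F')//; apply/funext => q; apply/funext => y; exact: pderivE.
Qed.

Lemma steering_temperature_derive q y :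
  is_derive q time_axis (steering_temperature^~ y) ('D_time_axis (steering_temperature^~ y) q).
Proof.
have [_ _ tT] := trigpoly_steering; have [F' _ FD] := trigpoly_derive time_axis tT.
have D := FD q y; rewrite (_ : 'D_time_axis _ q = F' q y)//; exact: derive_val.
Qed.

(** Parameter derivatives, space derivatives and products stay within [trigpoly]. This single fact
    gives both smoothness in time and joint smoothness in the end points. *)
Lemma trigpoly_forcing : trigpoly steering_forcing.
Proof.
have [tu _ tT] := trigpoly_steering.
have tL : trigpoly (fun q => laplacian (steering_temperature q)).
  rewrite (_ : (fun q => _) = fun q y =>
    pderiv 0 (pderiv 0 (steering_temperature q)) y + pderiv 1 (pderiv 1 (steering_temperature q)) y).
    have tPP i := trigpoly_pderivE i (trigpoly_pderivE i tT).
    exact: (trigpoly_add (tPP 0) (tPP 1)).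
  by apply/funext => q; apply/funext => y; exact: sum2E.
have tA : trigpoly (fun q => advection (steering_velocity q) (steering_temperature q)).
  rewrite (_ : (fun q => _) = fun q y =>
    steering_velocity q 0 y * pderiv 0 (steering_temperature q) y +
    steering_velocity q 1 y * pderiv 1 (steering_temperature q) y).
    have tP i := trigpoly_mul (tu i) (trigpoly_pderivE i tT).
    exact: (trigpoly_add (tP 0) (tP 1)).
  by apply/funext => q; apply/funext => y; exact: sum2E.
have [T' tT' TD] := trigpoly_derive time_axis tT.
apply: trigpoly_add; last first.
  by apply: trigpoly_opp; apply: trigpoly_scale => //; exact: elementary_cst.
apply: trigpoly_add => //.
rewrite (_ : (fun q y => _) = T')//; apply/funext => q; apply/funext => y.
by have := TD q y => D; exact: derive_val.
Qed.

(* Since cos^2 + sin^2 = 1 and the coefficients of a control may depend on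
   space, the frequency (1, 0) alone produces any forcing. *)
Definition steering_control (q0 q1 : config) : control := fun k l t y =>
  if k == (1, 0) then wave k l y * steering_forcing (q0, q1, t) y else 0.

Lemma steering_control_field (Z : {fset int * int}) (q0 q1 : config) : (1, 0) \in Z ->
  control_field Z (steering_control q0 q1) = fun t => steering_forcing (q0, q1, t).
Proof.
move=> Z10; apply/funext => t; apply/funext => y.
rewrite /control_field (big_fsetD1 _ Z10) /=.
rewrite [X in _ + X]big_seq [X in _ + X]big1 => [|k]; last first.
  rewrite !inE => /andP[kN _]; apply: big1 => l _.
  by rewrite /steering_control (negbTE kN) mulr0.
rewrite addr0 big_bool /steering_control eqxx /= !mulrA -mulrDl /wave /=.
by rewrite -!expr2 addrC cos2Dsin2 mul1r.
Qed.

Lemma steering_low_frequency (q0 q1 : config) : low_frequency (steering_control q0 q1).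
Proof.
move=> k l t y; rewrite /steering_control; case: eqP => [->|//].
by rewrite /= normr1 normr0.
Qed.

(** The linear part of the affine map from [t] to [(q0, q1, t)], in the form that
    [trigpoly_comp_affine] asks for. *)
Let slice_map (t : R^o) : E := (0, 0, t).

Let slice_linear : linear slice_map.
Proof.
move=> a u v; rewrite /slice_map.
have -> : a *: ((0, 0, u) : E) + (0, 0, v) = (a *: 0 + 0, a *: 0 + 0, a *: u + v) by [].
by rewrite !scaler0 !addr0.
Qed.

HB.instance Definition _ :=
  GRing.isLinear.Build R R^o E _ slice_map slice_linear.

Lemma trigpoly_slice (F : E -> R * R -> R) (q0 q1 : config) :
  trigpoly F -> trigpoly (fun t : R^o => F (q0, q1, t)).
Proof.
move=> tF; have sC : continuous slice_map.
  move=> t; have c0 : (fun=> 0 : config * config) @ (t : R^o) --> (0 : config * config).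
    exact: cvg_cst.
  have ct : id @ (t : R^o) --> (t : R^o) by exact: cvg_id.
  exact: (cvg_pair c0 ct).
have := trigpoly_comp_affine ((q0, q1, 0) : E) sC tF.
congr trigpoly; apply/funext => t; congr F.
have -> : (q0, q1, 0) + slice_map t = (q0 + 0, q1 + 0, 0 + t) by [].
by rewrite !addr0 add0r.
Qed.

Lemma steering_smooth_control (Z : {fset int * int}) (q0 q1 : config) :
  (1, 0) \in Z -> smooth_control Z (steering_control q0 q1).
Proof.
move=> Z10; split=> [k l t _ _|].
  rewrite /steering_control; case: (k == (1, 0)).
    exact: (trigpoly_in_L2 (q0, q1, t) (trigpoly_wave_mul k l trigpoly_forcing)).
  exact: (trigpoly_in_L2 (q0, q1, t) (trigpoly0 _)).
rewrite steering_control_field//; apply: trigpoly_smooth_L2.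
exact: trigpoly_slice trigpoly_forcing.
Qed.

Lemma steering_smooth_family (Z : {fset int * int}) :
  (1, 0) \in Z -> smooth_family Z steering_control.
Proof.
move=> Z10; rewrite /smooth_family.
rewrite (_ : (fun q => _) = steering_forcing).
  exact: trigpoly_smooth_L2 trigpoly_forcing.
by apply/funext => -[[q0 q1] t]; rewrite steering_control_field.
Qed.

Definition position (q0 q1 : config) (t : R) : R * R :=
  (interp c1 (q0, q1, t), interp c2 (q0, q1, t)).

(** The exponential of [phi] times the matrix J with rows (0, 1) and (-1, 0). As the gradient on the
    trajectory is the angular velocity times J, it solves the equation for [A]. *)
Definition rotation (phi : R) : 'M[R]_2 := \matrix_(i, j)
  if i == j then cos phi else if i == 0 then sin phi else - sin phi.

Lemma rate_eq0 (f : R -> R) pi (q0 q1 : config) t : f t = 0 -> rate f pi (q0, q1, t) = 0.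
Proof. by move=> ft; rewrite /rate ft mul0r. Qed.

(** Every amplitude in these fields contains a factor [rate step'] or [rate step''], so they vanish
    wherever the trajectory is. *)
Lemma steering_rest (q0 q1 : config) t y : step' t = 0 -> step'' t = 0 ->
  (forall j, steering_velocity (q0, q1, t) j y = 0) /\
  steering_temperature (q0, q1, t) y = 0.
Proof.
move=> s1 s2; split=> [j|]; rewrite /steering_velocity /steering_temperature
  /flow_velocity /flow_temperature /shear1 /shear2 /shear1' /shear2' /plane !rate_eq0//.
  by case: ifP => _; field.
by field.
Qed.

Lemma steering_solution (q0 q1 : config) :
  controlled_solution nu1 nu2 g (fun t => steering_forcing (q0, q1, t))
    (fun t => steering_velocity (q0, q1, t)) (fun t => steering_temperature (q0, q1, t))
    (position q0 q1) (fun t => direction (interp c3 (q0, q1, t)))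
    (fun t => rotation (interp c3 (q0, q1, t) - q0.2)).
Proof.
have [tu tp tT] := trigpoly_steering.
have [s0 s1 s2] := @elementary_steps R.
have i1D q := is_derive_interp c1 q; have i2D q := is_derive_interp c2 q.
have i3D q := is_derive_interp c3 q.
have r1D q := is_derive_rate c1 q is_derive_step'.
have r2D q := is_derive_rate c2 q is_derive_step'.
have r3D q := is_derive_rate c3 q is_derive_step'.
have curveC f : elementary f -> continuous (fun t : R => f ((q0, q1, t) : E)).
  move=> ef t.
  apply: (@continuous_comp _ _ _ (fun t : R => (q0, q1, t) : E) f).
    have c0 : (fun=> (q0, q1) : config * config) @ (t : R^o) --> ((q0, q1) : config * config).
      exact: cvg_cst.
    have ct : id @ (t : R^o) --> (t : R^o) by exact: cvg_id.
    exact: (cvg_pair c0 ct).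
  exact: elementary_continuous.
have velE t j : steering_velocity (q0, q1, t) j (position q0 q1 t) =
    if j == 0 then rate step' c1 (q0, q1, t) else rate step' c2 (q0, q1, t).
  exact: flow_velocity_at.
have gradE t i j : velocity_grad (steering_velocity (q0, q1, t)) (position q0 q1 t) i j =
    if i == j then 0 else if i == 0 then rate step' c3 (q0, q1, t)
    else - rate step' c3 (q0, q1, t) by exact: flow_gradient_at.
have e1 := elementary_interp c1C s0; have e2 := elementary_interp c2C s0.
have e3 := elementary_interp c3C s0.
split.
- by move=> j; apply: trigpoly_H5_curve; exact: trigpoly_slice (tu j).
- by apply: trigpoly_H5_curve; exact: trigpoly_slice tT.
- exists (fun t => steering_pressure (q0, q1, t)); split=> [t _|j t _].
    exact: (trigpoly_H5 (q0, q1, t) tp).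
  apply: trigpoly_L2_derivative; first exact: trigpoly_slice (tu j).
  move=> y; have M := @flow_momentum _ nu1 g _ _ _ _ _ _ _ _ _ _
    i1D i2D r1D r2D r3D g0 (q0, q1, t) j y.
  exact: slice_derive M.
- move=> t _; apply: trigpoly_L2_derivative; first exact: trigpoly_slice tT.
  (* The forcing was defined by solving this equation for it, so advection and diffusion cancel. *)
  move=> y; have := slice_derive (steering_temperature_derive (q0, q1, t) y).
  by congr is_derive; rewrite /steering_forcing; ring.
- by move=> t y _; exact: flow_incompressible.
- apply: continuous_subspaceT => t; exact: cvg_pair (curveC _ e1 t) (curveC _ e2 t).
- move=> t _; split; rewrite velE; exact: slice_derive.
- by move=> t _; rewrite /on_circle sum2E !mxE/= cos2Dsin2.
- move=> j; rewrite (_ : (fun s => _) = fun s => if j == 0 then cos (interp c3 (q0, q1, s))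
      else sin (interp c3 (q0, q1, s))).
    apply: continuous_subspaceT; case: (j == 0).
      exact: (curveC _ (elementary_cos e3)).
    exact: (curveC _ (elementary_sin e3)).
  by apply/funext => s; rewrite mxE.
- move=> t j _; move: (velocity_grad _ _) (gradE t) => G GE.
  have D := slice_derive (i3D (q0, q1, t)).
  rewrite /direction /perp /row2.
  rewrite (_ : (fun s => _) = fun s => if j == 0 then cos (interp c3 (q0, q1, s))
      else sin (interp c3 (q0, q1, s))); last by apply/funext => s; rewrite mxE.
  have cs := cos2Dsin2 (interp c3 (q0, q1, t)).
  rewrite !mxE sum2E !mxE !sum2E !mxE !GE /=.
  (* An infinitesimal rotation with angular velocity [o] turns every unit vector at speed [o]. *)
  have key (x y o : R) : x ^+ 2 + y ^+ 2 = 1 ->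
      (x * 0 + y * - o) * - y + (x * o + y * 0) * x = o.
    by move=> xy; rewrite -[RHS]mulr1 -xy; ring.
  by case: (j == 0); apply: is_derive_eq; rewrite key//; exact: mulrC.
- move=> t _; rewrite (expand_det_row _ 0) sum2E /cofactor !det_mx11 !mxE /=.
  rewrite (_ : (0 + 1 %% 2)%N = 1%N)// expr0 expr1 mul1r mulN1r opprK -!expr2.
  exact: cos2Dsin2.
- move=> i j; apply: continuous_subspaceT; rewrite (_ : (fun s => _) = fun s =>
      if i == j then cos (interp c3 (q0, q1, s) - q0.2)
      else if i == 0 then sin (interp c3 (q0, q1, s) - q0.2)
      else - sin (interp c3 (q0, q1, s) - q0.2)); last by apply/funext => s; rewrite mxE.
  have ed : elementary (fun q => interp c3 q - q0.2).
    by apply: elementary_add => //; exact: elementary_cst.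
  case: (i == j); first exact: (curveC _ (elementary_cos ed)).
  case: (i == 0); first exact: (curveC _ (elementary_sin ed)).
  exact: (curveC _ (elementary_opp (elementary_sin ed))).
- move=> t i j _; move: (velocity_grad _ _) (gradE t) => G GE.
  have D := slice_derive (i3D (q0, q1, t)).
  rewrite (_ : (fun s => _) = fun s =>
      if i == j then cos (interp c3 (q0, q1, s) - q0.2)
      else if i == 0 then sin (interp c3 (q0, q1, s) - q0.2)
      else - sin (interp c3 (q0, q1, s) - q0.2)); last by apply/funext => s; rewrite mxE.
  rewrite mxE sum2E !mxE !GE.
  by case: i j => -[|[|//]] ? [[|[|//]] ?] /=; apply: is_derive_eq;
    rewrite subr0 mulr0 ?addr0 ?add0r ?mulrN ?mulNr.
Qed.

Lemma steering_steers (Z : {fset int * int}) (q0 q1 : config) : (1, 0) \in Z ->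
  steers nu1 nu2 g Z (steering_control q0 q1)
    q0.1 (direction q0.2) q1.1 (direction q1.2).
Proof.
move=> Z10.
have torus_refl x : @torus_eq R x x by exists 0, 0; rewrite !mulr0 !addr0.
have interp0 pi : interp pi (q0, q1, 0) = pi q0.
  by rewrite /interp rate_eq0 ?addr0// /step; ring.
have interp1 pi : interp pi (q0, q1, 1) = pi q1.
  by rewrite /interp /rate /start /target /step /=; ring.
have [V0 T0] : (forall j y, steering_velocity (q0, q1, 0) j y = 0) /\
    (forall y, steering_temperature (q0, q1, 0) y = 0).
  have rest y : _ := @steering_rest q0 q1 0 y _ _.
  by split=> [j|] y; apply rest; rewrite /step' /step''; ring.
have [V1 T1] : (forall j y, steering_velocity (q0, q1, 1) j y = 0) /\
    (forall y, steering_temperature (q0, q1, 1) y = 0).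
  have rest y : _ := @steering_rest q0 q1 1 y _ _.
  by split=> [j|] y; apply rest; rewrite /step' /step''; ring.
exists (fun t => steering_velocity (q0, q1, t)), (fun t => steering_temperature (q0, q1, t)),
  (position q0 q1), (fun t => direction (interp c3 (q0, q1, t))),
  (fun t => rotation (interp c3 (q0, q1, t) - q0.2)).
split=> //.
- by rewrite steering_control_field//; exact: steering_solution.
- split; rewrite /position ?interp0//.
    by rewrite (_ : (_, _) = q0.1)//; case: (q0) => -[].
  apply/matrixP => i j; rewrite !mxE.
  (* [A] rotates by the angle turned since the start, which is 0 at time 0. *)
  rewrite (_ : c3 q0 - q0.2 = 0) ?cos0 ?sin0 ?oppr0; last exact: subrr.
  by case: eqP => // _; case: ifP.
- rewrite /position !interp1; split=> //.
  by rewrite (_ : (_, _) = q1.1)//; case: (q1) => -[].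
Qed.

End Control.

(** [acos] of the first coordinate is an angle whose sine is the absolute value of the second; the
    sign of the latter decides between this angle and its opposite. *)
Lemma on_circle_direction (R : realType) (v : 'rV[R]_2) :
  on_circle v -> exists phi, v = direction phi.
Proof.
rewrite /on_circle sum2E => vC.
have x1 : -1 <= v 0 0 <= 1.
  by apply/andP; split; nra.
have sE : sin (acos (v 0 0)) = `|v 0 1|.
  by rewrite sin_acos// -vC addrAC subrr add0r sqrtr_sqr.
have vE phi : v 0 0 = cos phi -> v 0 1 = sin phi -> v = direction phi.
  move=> vc vs; apply/matrixP => i j; rewrite ord1 mxE.
  by case: j => -[|[|//]] ? /=; rewrite -?vc -?vs; congr (v _ _); exact: val_inj.
have [y0|y0] := leP 0 (v 0 1).
  by exists (acos (v 0 0)); apply: vE; rewrite ?acosK// sE ger0_norm.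
exists (- acos (v 0 0)); apply: vE; rewrite ?cosN ?acosK// sinN sE.
by rewrite ltr0_norm// opprK.
Qed.

Unset Implicit Arguments.

Theorem proposition6p1 (R : realType) (nu1 nu2 g : R)
  (nu1_gt0 : 0 < nu1) (nu2_gt0 : 0 < nu2) (nu_lt2 : Num.min nu1 nu2 < 2)
  (g_neq0 : g != 0)
  (Z : {fset int * int})
  (Z_sym : forall k : int * int, k \in Z -> (- k.1, - k.2) \in Z)
  (Z10 : (1, 0) \in Z) (Z01 : (0, 1) \in Z) (Z02 : (0, 2) \in Z)
  (Z11 : (1, 1) \in Z) (ZN11 : (-1, 1) \in Z) :
  (forall (x0 : R * R) (v0 : 'rV[R]_2) (x1 : R * R) (v1 : 'rV[R]_2),
     on_circle v0 -> on_circle v1 ->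
     exists h : control,
       smooth_control Z h /\ steers nu1 nu2 g Z h x0 v0 x1 v1) /\
  (exists H : lifted_config -> lifted_config -> control,
     [/\ forall q0 q1 : lifted_config,
           [/\ smooth_control Z (H q0 q1),
               steers nu1 nu2 g Z (H q0 q1)
                 q0.1 (direction q0.2) q1.1 (direction q1.2)
             & low_frequency (H q0 q1)]
       & smooth_family Z H]).
Proof.
split; last first.
  exists (steering_control nu1 nu2 g); split; last exact: steering_smooth_family.
  move=> q0 q1; split; [exact: steering_smooth_control|exact: steering_steers|].
  exact: steering_low_frequency.
move=> x0 v0 x1 v1 /on_circle_direction[phi0 ->] /on_circle_direction[phi1 ->].
(* The given lifts together with any angles of the two directions are configurations, to which the
   family applies. *)
pose q0 : lifted_config := (x0, phi0); pose q1 : lifted_config := (x1, phi1).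
exists (steering_control nu1 nu2 g q0 q1); split; first exact: steering_smooth_control.
exact: (steering_steers nu1 nu2 g_neq0 q0 q1 Z10).
Qed.
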